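(* Let $(D,E,\mathbf{w})$ be an arbitrary weighted oriented graph, with vertex set $\{1,\dots,n\}$, and let $I(D,\mathbf{w}) \subseteq S = \mathrm{k}[x_1,\dots,x_n]$ be its edge ideal. Then $$\operatorname{reg}\left(\overline{I(D,\mathbf{w})}\right) \le \operatorname{reg}\left(I(D,\mathbf{w})\right).$$
   Context: $\mathrm{k}$ is an arbitrary field and $S=\mathrm{k}[x_1,\dots,x_n]$ is the standard graded polynomial ring. A weighted oriented graph $(D,E,\mathbf{w})$ consists of a finite simple oriented graph $D$ (no loops, no multiple edges, and at most one of $(i,j)$, $(j,i)$ is an edge) without isolated vertices, with vertex set $V(D)=[n]=\{1,\dots,n\}$ and set $E=E(D)$ of directed edges, together with a weight function $\mathbf{w}:V(D)\to\mathbb{Z}_+$ (positive integers) such that $\mathbf{w}(j)=1$ whenever $j$ is a source vertex, i.e. whenever there is no $i$ with $(i,j)\in E(D)$. Its edge ideal is $$I(D,\mathbf{w})=\left(x_i x_j^{\mathbf{w}(j)} \mid (i,j)\in E(D)\right)\subseteq S.$$ For an ideal $I$ of $S$, $\overline{I}$ denotes its integral closure. The symbol $\operatorname{reg}$ denotes Castelnuovo-Mumford regularity: with $\mathfrak{m}=(x_1,\dots,x_n)$, for a finitely generated graded $S$-module $L$, $\operatorname{reg}(L)=\max\{i+j\mid H^i_{\mathfrak{m}}(L)_j\ne 0\}$, where $H^i_{\mathfrak m}$ is local cohomology. *)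

(* Defs.v *)
From HB Require Import structures.
From mathcomp Require Import all_boot all_order all_algebra.
From mathcomp Require Export mpoly.
From mathcomp Require Export boolp classical_sets constructive_ereal.

Set Implicit Arguments.
Unset Strict Implicit.
Unset Printing Implicit Defensive.

Import Order.TTheory GRing.Theory Num.Theory.

Local Open Scope ring_scope.
Local Open Scope classical_set_scope.

(* Ideals of a commutative ring are represented by their sets of elements. *)
Section Ideals.
Variable R : comNzRingType.

Definition ideal_span (G : set R) : set R :=
  [set f | exists m (c g : 'I_m -> R),
     (forall i, G (g i)) /\ f = \sum_(i < m) c i * g i].

(* The power of exponent 0 is the unit ideal. *)
Definition ideal_exp (I : set R) (d : nat) : set R :=
  ideal_span [set f | exists g : 'I_d -> R,
     (forall i, I (g i)) /\ f = \prod_(i < d) g i].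

(* f is integral over I when
   f ^ d + a_1 f ^ (d - 1) + ... + a_d = 0 with a_i in I ^ i and d > 0. *)
Definition integral_closure (I : set R) : set R :=
  [set f | exists (d : nat) (a : nat -> R),
     [/\ (0 < d)%N,
         forall i, (1 <= i <= d)%N -> ideal_exp I i (a i)
       & f ^+ d + \sum_(1 <= i < d.+1) a i * f ^+ (d - i) = 0]].

End Ideals.

(* The vertices 1, ..., n are the elements 0, ..., n - 1 of 'I_n. *)
Record weighted_oriented_graph (n : nat) := WeightedOrientedGraph {
  edge : rel 'I_n;
  weight : 'I_n -> nat;
  edge_loopless : forall i, ~~ edge i i;
  edge_oriented : forall i j, edge i j -> ~~ edge j i;
  no_isolated_vertex : forall i, exists j, edge i j || edge j i;
  weight_gt0 : forall j, (0 < weight j)%N;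
  weight_source : forall j, (forall i, ~~ edge i j) -> weight j = 1%N
}.

Definition edge_ideal (k : fieldType) (n : nat)
    (D : weighted_oriented_graph n) : set {mpoly k[n]} :=
  ideal_span [set f | exists i j : 'I_n,
    edge D i j /\ f = 'X_i * 'X_j ^+ weight D j].

Arguments edge_ideal k {n} D.

(* Local cohomology with support in m = (x_1, ..., x_n), as the cohomology of
   the Cech complex of x_1, ..., x_n.
   A graded module is an S-submodule of M given by its homogeneous components
   L : int -> set M. An element u / x_A ^ t of the localization of the module
   at x_A = prod_(l in A) x_l is represented by the pair (u, t); such fractions
   are compared by loc_eq, never by Leibniz equality. *)
Section LocalCohomology.
Variables (k : fieldType) (n : nat).
Local Notation S := {mpoly k[n]}.
Variable M : lmodType S.
Implicit Types (A B : {set 'I_n}) (L : int -> set M) (x y : M * nat).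

Definition xprod A : S := \prod_(l in A) 'X_l.

Definition loc_eq A x y : Prop :=
  exists r : nat, xprod A ^+ r *:
    (xprod A ^+ y.2 *: x.1 - xprod A ^+ x.2 *: y.1) = 0.

Definition loc_zero : M * nat := (0, 0%N).

Definition loc_add A x y : M * nat :=
  (xprod A ^+ y.2 *: x.1 + xprod A ^+ x.2 *: y.1, (x.2 + y.2)%N).

Definition loc_scale (a : S) x : M * nat := (a *: x.1, x.2).

(* From the localization at x_(B \ l) to the localization at x_B, for l in B:
   u / x_(B \ l) ^ t = (x_l ^ t u) / x_B ^ t. *)
Definition loc_map (l : 'I_n) x : M * nat := ('X_l ^+ x.2 *: x.1, x.2).

Definition loc_degree L A (j : int) : set (M * nat) :=
  [set x | L (j + (x.2 * #|A|)%N%:Z) x.1].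

(* Degree j part of the i-th term of the complex; only the values c A with
   #|A| = i are meaningful. *)
Definition cech_cochain L (i : nat) (j : int) :
    set ({set 'I_n} -> M * nat) :=
  [set c | forall A, #|A| = i -> loc_degree L A j (c A)].

Definition cech_diff (c : {set 'I_n} -> M * nat) B : M * nat :=
  \big[loc_add B / loc_zero]_(l in B)
    loc_scale ((-1) ^+ #|[set a in B | (a < l)%N]%SET|)
      (loc_map l (c (B :\ l))).

Definition cech_cocycle L (i : nat) (j : int) :
    set ({set 'I_n} -> M * nat) :=
  [set c | cech_cochain L i j c /\
     forall B, #|B| = i.+1 -> loc_eq B (cech_diff c B) loc_zero].

(* For i = 0 the only coboundary is 0: cech_diff b set0 is an empty sum. *)
Definition cech_coboundary L (i : nat) (j : int) :
    set ({set 'I_n} -> M * nat) :=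
  [set c | exists2 b, cech_cochain L i.-1 j b &
     forall A, #|A| = i -> loc_eq A (c A) (cech_diff b A)].

(* The degree j component of the i-th local cohomology module is nonzero. *)
Definition local_cohomology_neq0 L (i : nat) (j : int) : Prop :=
  ~ (cech_cocycle L i j `<=` cech_coboundary L i j).

(* The maximum of the degrees i + j, as an element of \bar int; it is -oo for
   the zero module. *)
Definition reg L : \bar int :=
  supremum -oo%E
    [set d%:E | d in [set d : int | exists (i : nat) (j : int),
       local_cohomology_neq0 L i j /\ d = i%:Z + j]].

Lemma reg_max L (r : int) :
  (exists (i : nat) (j : int), local_cohomology_neq0 L i j /\ r = i%:Z + j) ->
  (forall (i : nat) (j : int), local_cohomology_neq0 L i j -> i%:Z + j <= r) ->
  reg L = r%:E.
Proof.
move=> Lr ler; rewrite /reg /supremum.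
set A := [set _%:E | _ in _].
have Ar : A r%:E by exists r.
case: ifPn => [/eqP A0|_]; first by rewrite A0 in Ar.
have supr : supremums A r%:E.
  split; last by move=> y; apply.
  by move=> _ [_ [i [j [Lij ->]]] <-]; rewrite lee_fin ler.
by apply: xget_unique => // y supy; exact: is_subset1_supremums supy supr.
Qed.

End LocalCohomology.

(* The degree j component of an ideal I of the standard graded polynomial
   ring; it is 0 for j < 0. *)
Definition ideal_component (k : fieldType) (n : nat) (I : set {mpoly k[n]})
    (j : int) : set {mpoly k[n]}^o :=
  [set f | I f /\ (f = 0 \/
     exists2 d : nat, j = d%:Z & (f : {mpoly k[n]}) \is d.-homog)].

Definition reg_ideal (k : fieldType) (n : nat) (I : set {mpoly k[n]}) :
    \bar int :=
  reg (ideal_component I).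

(* Main.v *)
Require Import Defs.
From HB Require Import structures.
From mathcomp Require Import all_boot all_order all_algebra zify.

Set Implicit Arguments.
Unset Strict Implicit.
Unset Printing Implicit Defensive.

Import Order.TTheory GRing.Theory Num.Theory.

(** The local cohomology of a monomial ideal splits along Z^n: in degree a it is
the cohomology of the cochains on the family of the vertex sets A such that x^a
lies in the localization of the ideal at x_A ([local_cohomology_monomial]). So it
is enough to start from a degree a and an index i at which the family of the
integral closure J has cohomology, and to find b and i' at which the family of
the edge ideal I has cohomology and i + |a| <= i' + |b|
([in_ideal_at_dominates]).

Monomial membership in J is a packing problem: x^m lies in J if and only if, for
some r > 0, the product of r generators of I, taken with repetition, divides
x^(rm) ([integral_closureP]). One direction is clear. For the other one, if f is
integral over I, a fixed nonzero c satisfies c f^N in I^N for all N; the leading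
monomials give a packing for each N, and the difference of two comparable
packings is a packing for the leading monomial of f, which can then be
subtracted. That J is closed under subtraction comes from the Rees algebra.

Let P and N be the sets of the positive and of the negative coordinates of a, W
the set of the out-neighbours of P, and w the weights. If a_j >= w_j for some j,
the family of J is a cone. Otherwise pass to the complement of the family among
the sets containing N. It consists of the independent sets A that contain N,
avoid W, and leave no room in a for a packing by the edges inside P and by the
pure powers x_q^(w_q) of the vertices q in P that A hits, i.e. that have an
in-neighbour in A outside P ([in_closure_atE]). If the packing condition is
dropped, this is the complement of the family of I in the degree which is
w_j - 1 on P and a_j elsewhere; it is larger than a by the slack, the sum of the
w_j - 1 - a_j over P.

The packing condition is removed by treating the vertices q of P one after the
other. Exact sequences show that one may forbid all in-neighbours of q outside P,
or declare q to be hit anyway, or do both, which costs one cohomological degree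
([branch_family_resolve]). At the end the condition only says that the set T of
the vertices declared hit is not packable. Two vertices of T with 2 a_j >= w_j
would form a packing; so all but at most one vertex of T have 2 a_j < w_j and add
at least 1 to the slack, and the slack covers the cost ([slack_bound]). The
remaining unit is found in a vertex of P without in-neighbour in P, which costs
nothing since forbidding its in-neighbours gives a cone, or else by packings of
at most three items. Finally the forbidden vertices are restored one by one, or
given the exponent -1, which raises the cohomological degree by one
([indep_over_restore]). *)

(** * Cochains on families of vertex sets *)

Local Open Scope ring_scope.

Section Cochains.
Variables (k : fieldType) (n : nat).
Local Notation vset := {set 'I_n}.
Implicit Types (A B : vset) (F G : pred vset) (f g h : vset -> k).

Definition cech_sign B (l : 'I_n) : k := (-1) ^+ #|[set a in B | (a < l)%N]|.

Definition coboundary f B : k := \sum_(l in B) cech_sign B l * f (B :\ l).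

(** The functions supported in a family play the part of its cochains of all
degrees at once: the number of elements of a set is its degree. *)
Definition supported F f := forall A, ~~ F A -> f A = 0.

(** Vanishing of the cohomology of degree i. The conditions only bear on members
of F, so that the complex of a convex family is a subquotient of the complex of
all subsets. *)
Definition acyclic (i : nat) F :=
  forall f, supported F f ->
    (forall B, F B -> #|B| = i.+1 -> coboundary f B = 0) ->
    exists2 g, supported F g & forall A, F A -> #|A| = i -> f A = coboundary g A.

Definition convex F := forall A B C, F A -> F C -> A \subset B -> B \subset C -> F B.

Lemma cech_sign_sqr B l : cech_sign B l * cech_sign B l = 1.
Proof. by rewrite -expr2 sqrr_sign. Qed.

(** Removing the smaller of l and m changes the rank of the larger one, and not
conversely. *)
Lemma cech_sign_swap B l m : l \in B -> m \in B -> l != m ->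
  cech_sign B l * cech_sign (B :\ l) m = - (cech_sign B m * cech_sign (B :\ m) l).
Proof.
have key : forall l m : 'I_n, l \in B -> (l < m)%N ->
  cech_sign B l * cech_sign (B :\ l) m = - (cech_sign B m * cech_sign (B :\ m) l).
  move=> {}l {}m lB ltlm; rewrite /cech_sign.
  have -> : [set a in B :\ m | (a < l)%N] = [set a in B | (a < l)%N].
    apply/setP=> a; rewrite !inE; case: (eqVneq a m) => //= ->.
    by rewrite [(m < l)%N]ltnNge ltnW ?andbF.
  have -> : [set a in B | (a < m)%N] = l |: [set a in B :\ l | (a < m)%N].
    apply/setP=> a; rewrite !inE; case: (eqVneq a l) => [->|//].
    by rewrite lB ltlm.
  by rewrite cardsU1 !inE eqxx /= exprS mulN1r mulNr opprK mulrC.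
move=> lB mB; rewrite -val_eqE neq_ltn => /orP[/key->//|/key->//].
by rewrite opprK.
Qed.

Lemma coboundary_coboundary f B : coboundary (coboundary f) B = 0.
Proof.
pose T l m := cech_sign B l * cech_sign (B :\ l) m * f (B :\ l :\ m).
have -> : coboundary (coboundary f) B =
    \sum_(l in B) \sum_(m in B) (if l != m then T l m else 0).
  apply: eq_bigr => l lB; rewrite /coboundary mulr_sumr -big_mkcondr /=.
  rewrite (eq_bigl (fun m => (m \in B) && (l != m))); last first.
    by move=> m; rewrite !inE andbC eq_sym.
  by apply: eq_bigr => m _; rewrite mulrA.
rewrite (eq_bigr (fun l : 'I_n => \sum_(m in B) ((if (l < m)%N then T l m else 0)
   + (if (m < l)%N then T l m else 0)))); last first.
  move=> l _; apply: eq_bigr => m _; rewrite -val_eqE /=.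
  by case: ltngtP; rewrite ?addr0 ?add0r.
under eq_bigr do rewrite big_split /=.
rewrite big_split /= [X in _ + X]exchange_big /= -big_split /=.
apply: big1 => l lB; rewrite -big_split /=; apply: big1 => m mB.
case: ltnP => [ltlm|_]; last by rewrite addr0.
rewrite /T cech_sign_swap //; last by rewrite -val_eqE neq_ltn ltlm.
by rewrite setDDl [[set l] :|: _]setUC -setDDl mulNr addNr.
Qed.

Lemma eq_coboundary f g B : (forall l, l \in B -> f (B :\ l) = g (B :\ l)) ->
  coboundary f B = coboundary g B.
Proof. by move=> fg; apply: eq_bigr => l /fg ->. Qed.

Lemma coboundaryB f g B : coboundary (fun A => f A - g A) B = coboundary f B - coboundary g B.
Proof. by rewrite /coboundary -sumrB; apply: eq_bigr => l _; rewrite mulrBr. Qed.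

Lemma coboundaryD f g B : coboundary (fun A => f A + g A) B = coboundary f B + coboundary g B.
Proof. by rewrite /coboundary -big_split; apply: eq_bigr => l _; rewrite mulrDr. Qed.

Definition restrict_to F f A : k := if F A then f A else 0.

Lemma restrict_supported F f : supported F (restrict_to F f).
Proof. by move=> A; rewrite /restrict_to => /negPf ->. Qed.

Lemma restrictE F f A : F A -> restrict_to F f A = f A.
Proof. by rewrite /restrict_to => ->. Qed.

(** The square of the differential still vanishes within F: a set between a
member of the support of f and B belongs to F by convexity. *)
Lemma coboundary_restrict F f B : convex F -> F B -> supported F f ->
  coboundary (restrict_to F (coboundary f)) B = 0.
Proof.
move=> cF FB sf; rewrite -[RHS](coboundary_coboundary f B).
apply: eq_coboundary => l lB; rewrite /restrict_to; case: ifPn => // nF.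
symmetry; apply: big1 => m mB; rewrite (sf _) ?mulr0 //.
apply: contra nF => FBlm; apply: cF FBlm FB _ _; apply: subD1set.
Qed.

Lemma acyclic_ext i F G : F =1 G -> acyclic i F -> acyclic i G.
Proof.
move=> FG aF f sf cf; have [||g sg gP] := aF f.
- by move=> A; rewrite FG; apply: sf.
- by move=> B; rewrite FG; apply: cf.
exists g => [A|A]; first by rewrite -FG; apply: sg.
by rewrite -FG; apply: gP.
Qed.

Lemma acyclic_empty i F : (forall A, ~~ F A) -> acyclic i F.
Proof.
move=> F0 f sf _; exists (fun=> 0) => // A FA; by have := F0 A; rewrite FA.
Qed.

(** Adding p to a set is a contracting homotopy. *)
Lemma acyclic_cone i F (p : 'I_n) :
  (forall A, F (p |: A) = F (A :\ p)) -> acyclic i F.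
Proof.
move=> tog f sf cf.
have togU A : F (p |: A) = F A.
  case: (boolP (p \in A)) => pA; first by rewrite (setUidPr _) ?sub1set.
  by rewrite tog; congr F; apply/setP=> x; rewrite !inE; case: eqVneq => // ->; rewrite (negPf pA).
(* the primitive is f evaluated at A with p added *)
pose g A := if p \in A then 0 else cech_sign (p |: A) p * f (p |: A).
exists g.
  by move=> A nFA; rewrite /g; case: ifP => // _; rewrite sf ?mulr0 ?togU.
move=> A FA cA; case: (boolP (p \in A)) => pA.
  rewrite /coboundary (bigD1 p) //= big1 ?addr0; last first.
    by move=> l /andP[lA lp]; rewrite /g !inE eq_sym lp pA mulr0.
  by rewrite /g !inE eqxx /= setD1K // mulrA cech_sign_sqr mul1r.
set B := p |: A.
have pB : p \in B by rewrite !inE eqxx.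
have BpA : B :\ p = A by rewrite /B setU1K.
have := cf B; rewrite togU cardsU1 pA cA add1n => /(_ FA erefl).
rewrite /coboundary (bigD1 p) //= BpA => /(canRL (addrK _)); rewrite sub0r.
move=> /(congr1 ( *%R (cech_sign B p))); rewrite mulrA cech_sign_sqr mul1r => ->.
rewrite -sumrN mulr_sumr.
rewrite (eq_bigl (fun l => l \in A)); last first.
  by move=> l; rewrite !inE; case: (eqVneq l p) => [->|_] /=; rewrite ?(negPf pA) ?andbT.
apply: eq_bigr => l lA.
have lp : l != p by apply: contraNneq pA => <-.
have lB : l \in B by rewrite !inE lA orbT.
have e : p |: (A :\ l) = B :\ l.
  by apply/setP=> x; rewrite !inE; case: eqVneq => // ->; rewrite eq_sym lp.
rewrite /g !inE (negPf pA) andbF e mulrN !mulrA -mulNr; congr (_ * _).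
rewrite -[in cech_sign A l]BpA.
have := cech_sign_swap pB lB; rewrite eq_sym => /(_ lp) sw.
have -> : cech_sign (B :\ p) l = - (cech_sign B p * (cech_sign B l * cech_sign (B :\ l) p)).
  by rewrite -mulrN -sw mulrA cech_sign_sqr mul1r.
by rewrite !mulNr -!mulrA cech_sign_sqr mulr1.
Qed.

(** F1 is an upward closed part of F and F2 its complement, so cochains on F1 form
a subcomplex with quotient the cochains on F2. The three lemmas of this section
are the three exactness statements of the resulting long exact sequence. *)
Section UpperPart.
Variables (F F1 F2 : pred vset).
Hypothesis convexF : convex F.
Hypothesis F_disj : forall A, F A = F1 A || F2 A.
Hypothesis F12 : forall A, F1 A -> ~~ F2 A.
Hypothesis F1_up : forall A B, F1 A -> F B -> A \subset B -> F1 B.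

Let F1F A : F1 A -> F A. Proof. by rewrite F_disj => ->. Qed.
Let F2F A : F2 A -> F A. Proof. by rewrite F_disj => ->; rewrite orbT. Qed.
Let F2_dn A B : F2 B -> F A -> A \subset B -> F2 A.
Proof.
move=> F2B FA sAB; move: (FA); rewrite F_disj => /orP[F1A|//].
by have /F12 := F1_up F1A (F2F F2B) sAB; rewrite F2B.
Qed.
Let sup1 f : supported F1 f -> supported F f.
Proof. by move=> sf A; rewrite F_disj negb_or => /andP[/sf]. Qed.
Let sup2 f : supported F2 f -> supported F f.
Proof. by move=> sf A; rewrite F_disj negb_or => /andP[_ /sf]. Qed.

Let cob1_F2 f B : supported F1 f -> F2 B -> coboundary f B = 0.
Proof.
move=> sf F2B; apply: big1 => l _; rewrite sf ?mulr0 //.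
apply/negP => F1B; have /F12 := F1_up F1B (F2F F2B) (subD1set _ _).
by rewrite F2B.
Qed.
Let cob_restr2 f B : supported F f -> F2 B -> coboundary (restrict_to F2 f) B = coboundary f B.
Proof.
move=> sf F2B; apply: eq_coboundary => l _; rewrite /restrict_to; case: ifPn => // nF2.
rewrite sf //; apply: contra nF2 => FB; apply: F2_dn F2B FB (subD1set _ _).
Qed.

Lemma acyclic_union i : acyclic i F1 -> acyclic i F2 -> acyclic i F.
Proof.
move=> a1 a2 f sf cf.
have [||g2 sg2 g2P] := a2 (restrict_to F2 f); first exact: restrict_supported.
  by move=> B F2B cB; rewrite cob_restr2 // cf // F2F.
(* subtracting the coboundary of g2 leaves a cocycle supported in F1 *)
pose f1 A := f A - restrict_to F (coboundary g2) A.
have [||g1 sg1 g1P] := a1 (restrict_to F1 f1); first exact: restrict_supported.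
  move=> B F1B cB; rewrite (eq_coboundary (g := f1)) => [|l lB].
    by rewrite coboundaryB cf ?F1F // coboundary_restrict ?subr0 ?F1F //; apply: sup2.
  rewrite /restrict_to; case: ifPn => // nF1; rewrite /f1 /restrict_to F_disj (negPf nF1) /=.
  have cBl : #|B :\ l| = i by move: cB; rewrite (cardsD1 l) lB => -[].
  case: ifPn => [F2A|nF2]; first by rewrite -g2P // /restrict_to F2A subrr.
  by rewrite sf ?subr0 // F_disj negb_or nF1.
exists (fun A => g1 A + g2 A).
  by move=> A nFA; rewrite (sup1 sg1) // (sup2 sg2) // addr0.
move=> A FA cA; rewrite coboundaryD; move: (FA); rewrite F_disj => /orP[F1A|F2A].
  by rewrite -g1P // restrictE // /f1 restrictE // subrK.
by rewrite cob1_F2 // add0r -g2P // restrictE.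
Qed.

Lemma acyclic_upper i : acyclic i F ->
  (forall i', i = i'.+1 -> acyclic i' F2) -> acyclic i F1.
Proof.
move=> aF a2 f sf cf; have [||g sg gP] := aF f; first exact: sup1.
  move=> B FB cB; move: FB; rewrite F_disj => /orP[F1B|F2B]; first exact: cf.
  exact: cob1_F2.
case: i a2 {aF} cf gP => [|i] a2 cf gP.
  exists (fun=> 0) => // A F1A cA; rewrite gP ?F1F //.
  by rewrite (cards0_eq cA) /coboundary !big_set0.
have [||h sh hP] := a2 i erefl (restrict_to F2 g); first exact: restrict_supported.
  move=> B F2B cB; rewrite cob_restr2 // -gP ?F2F // sf //.
  by apply/negP => /F12; rewrite F2B.
(* correcting g by a coboundary makes it vanish on F2 in degree i *)
pose g1 A := g A - restrict_to F (coboundary h) A.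
exists (restrict_to F1 g1); first exact: restrict_supported.
move=> A F1A cA; rewrite gP ?F1F // (eq_coboundary (f := restrict_to F1 g1) (g := g1)).
  by rewrite coboundaryB coboundary_restrict ?subr0 ?F1F //; apply: sup2.
move=> l lA; rewrite /restrict_to; case: ifPn => // nF1.
rewrite /g1 /restrict_to F_disj (negPf nF1) /=.
have cAl : #|A :\ l| = i by move: cA; rewrite (cardsD1 l) lA => -[].
case: ifPn => [F2A|nF2]; first by rewrite -hP // /restrict_to F2A subrr.
by rewrite sg ?subr0 // F_disj negb_or nF1.
Qed.

Lemma acyclic_lower i : acyclic i F -> acyclic i.+1 F1 -> acyclic i F2.
Proof.
move=> aF a1 f sf cf.
(* the coboundary of f is the image of f under the connecting map *)
have [||g1 sg1 g1P] := a1 (restrict_to F1 (coboundary f)); first exact: restrict_supported.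
  move=> B F1B cB; rewrite (eq_coboundary (g := restrict_to F (coboundary f))) => [|l lB].
    by rewrite coboundary_restrict ?F1F //; apply: sup2.
  have cBl : #|B :\ l| = i.+1 by move: cB; rewrite (cardsD1 l) lB => -[].
  rewrite /restrict_to F_disj; case: ifPn => //= nF1; case: ifPn => // F2A.
  by rewrite cf.
have [||h sh hP] := aF (fun A => f A - g1 A).
- by move=> A nFA; rewrite (sup2 sf) // (sup1 sg1) // subr0.
- move=> B FB cB; rewrite coboundaryB; move: FB; rewrite F_disj => /orP[F1B|F2B].
    by rewrite -g1P // restrictE // subrr.
  by rewrite cf // cob1_F2 // subr0.
exists (restrict_to F2 h); first exact: restrict_supported.
move=> A F2A cA; rewrite cob_restr2 // -hP ?F2F // sg1 ?subr0 //.
by apply/negP => /F12; rewrite F2A.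
Qed.
End UpperPart.

(** The same sequence for the part of F cut out by an upward closed condition Q,
in the contrapositive form in which it is used. *)
Section Cut.
Variables (F Q : pred vset).
Hypothesis convexF : convex F.
Hypothesis Q_up : forall A B, Q A -> A \subset B -> Q B.

Let cutE A : F A = (F A && Q A) || (F A && ~~ Q A).
Proof. by case: (F A); case: (Q A). Qed.
Let cut_disj A : F A && Q A -> ~~ (F A && ~~ Q A).
Proof. by case: (F A); case: (Q A). Qed.
Let cut_up A B : F A && Q A -> F B -> A \subset B -> F B && Q B.
Proof. by case/andP=> _ QA -> /(Q_up QA). Qed.

Lemma nonacyclic_cut i : ~ acyclic i F ->
  ~ acyclic i (fun A => F A && Q A) \/ ~ acyclic i (fun A => F A && ~~ Q A).
Proof.
move=> nF; case: (EM (acyclic i (fun A => F A && Q A))) => [a1|]; last by left.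
by right=> a2; apply: nF; apply: (acyclic_union convexF cutE cut_disj cut_up a1 a2).
Qed.

Lemma nonacyclic_upper i : ~ acyclic i (fun A => F A && Q A) ->
  ~ acyclic i F \/
  exists2 i', i = i'.+1 & ~ acyclic i' (fun A => F A && ~~ Q A).
Proof.
move=> nF1; case: (EM (acyclic i F)) => [aF|]; last by left.
right; apply: contrapT => no; apply: nF1; apply: (acyclic_upper convexF cutE cut_disj cut_up aF).
by move=> i' ei; apply: contrapT => ni'; apply: no; exists i'.
Qed.

Lemma nonacyclic_lower i : ~ acyclic i (fun A => F A && ~~ Q A) ->
  ~ acyclic i F \/ ~ acyclic i.+1 (fun A => F A && Q A).
Proof.
move=> nF2; case: (EM (acyclic i F)) => [aF|]; last by left.
by right=> a1; apply: nF2; apply: (acyclic_lower convexF cutE cut_disj cut_up aF a1).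
Qed.
End Cut.
End Cochains.

(** * Packings and the slack *)

Local Close Scope ring_scope.

Section Packings.
Variables (n : nat) (D : weighted_oriented_graph n).
Local Notation vset := {set 'I_n}.
Local Notation w := (weight D).

(** The exponent of x_v in the product of the generators of the edges in s. *)
Definition load (s : seq ('I_n * 'I_n)) (v : 'I_n) : nat :=
  \sum_(e <- s) ((e.1 == v) + (e.2 == v) * w v).

Definition independent (A : vset) :=
  [forall i in A, forall j in A, ~~ edge D i j].

Lemma independentP (A : vset) :
  reflect (forall i j, i \in A -> j \in A -> ~~ edge D i j) (independent A).
Proof.
apply: (iffP forall_inP) => [h i j iA jA|h i iA]; first exact: (forall_inP (h i iA)).
by apply/forall_inP => j jA; apply: h.
Qed.

(** Packings after inverting the variables of a set A. An item (None, q) is the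
pure power x_q ^ w q, which is what remains of the generator of an edge from A to
q; [room] is the exponent available on P. *)
Section LocalPackings.
Variables (P : vset) (room : 'I_n -> nat).

Definition open_load (s : seq (option 'I_n * 'I_n)) (v : 'I_n) : nat :=
  \sum_(e <- s) ((e.1 == Some v) + (e.2 == v) * w v).

Definition allowed (T : vset) (e : option 'I_n * 'I_n) :=
  (e.2 \in P) && (if e.1 is Some i then (i \in P) && edge D i e.2 else e.2 \in T).

Definition packable (T : vset) : bool :=
  `[< exists s, [/\ (0 < size s)%N, all (allowed T) s &
        forall v, v \in P -> (open_load s v <= size s * room v)%N] >].

Lemma packableS (T T' : vset) : T \subset T' -> packable T -> packable T'.
Proof.
move=> sTT' /asboolP[s [s0 /allP sl sv]]; apply/asboolP; exists s; split=> //.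
apply/allP => e /sl; rewrite /allowed; case: e => [[i|] j] //= /andP[-> /= jT].
exact: subsetP sTT' _ jT.
Qed.

Definition out_nbrs : vset := [set j | [exists i in P, edge D i j]].

Lemma out_nbrsP j : reflect (exists2 i, i \in P & edge D i j) (j \in out_nbrs).
Proof.
rewrite inE; apply: (iffP exists_inP) => [] [i]; exists i => //.
Qed.

Hypothesis room_gt0 : forall j, j \in P -> (0 < room j)%N.
Hypothesis room_ltw : forall j, j \in P -> (room j < w j)%N.

Definition slack j := (w j - 1 - room j)%N.

(** Call a vertex of T heavy when 2 * room >= w. Two heavy vertices form a packing,
and a light vertex has slack at least its room, hence at least 1: so the slack of
T is at least #|T| - 1. If the bound failed, all inequalities would be sharp: T
would lie in Q, there would be one heavy vertex h, of slack 0, the light ones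
would have room 1 and weight 3, and the vertices of P outside T would have
slack 0. As Q would be P, each vertex of P would have an in-neighbour in P, and
there would be a packing by two or three items. *)
Lemma slack_bound (Q T : vset) : Q :|: T = P ->
  (forall p, p \in Q -> p \in out_nbrs) -> ~~ packable T -> packable P ->
  (#|Q :&: T| <= \sum_(j in P) slack j)%N.
Proof.
move=> DTP Qout nT tP; rewrite leqNgt; apply/negP => lt_slack.
have sTP : T \subset P by rewrite -DTP subsetUr.
have test_in s : (0 < size s)%N -> all (allowed T) s ->
    (forall v, v \in P -> (open_load s v <= size s * room v)%N) -> False.
  by move=> s0 sl sv; case/negP: nT; apply/asboolP; exists s.
have inP v : v \in T -> v \in P := subsetP sTP v.
have heavy1 g h : g \in T -> h \in T -> (w g <= 2 * room g)%N ->
    (w h <= 2 * room h)%N -> g = h.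
  move=> gT hT wg wh; apply/eqP/negPn/negP => ngh.
  apply: (test_in [:: (None, g); (None, h)]) => //=.
    by rewrite /allowed /= gT hT !inP.
  move=> v vP; rewrite /open_load !big_cons big_nil /=.
  clear - wg wh ngh.
  case: (eqVneq g v) => [<-|_]; first by rewrite eq_sym (negPf ngh); lia.
  case: (eqVneq h v) => [<-|_]; lia.
have light1 g : g \in T -> ~~ (w g <= 2 * room g)%N -> (0 < slack g)%N.
  by move=> gT; have := room_gt0 (inP _ gT); rewrite /slack; lia.
have slackT (A : vset) : (forall g, g \in A -> 0 < slack g)%N ->
    (#|A| <= \sum_(j in A) slack j)%N.
  by move=> A0; rewrite -sum1_card; apply: leq_sum.
have capT : (#|Q :&: T| <= #|T|)%N by rewrite subset_leq_card ?subsetIr.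
have sumPT : (\sum_(j in P) slack j =
    \sum_(j in T) slack j + \sum_(j in P :\: T) slack j)%N.
  rewrite [LHS](big_setID T) /=; congr (_ + _).
  by rewrite (setIidPr sTP).
case: (pickP (fun h => (h \in T) && (w h <= 2 * room h)%N)) => [h /andP[hT wh]|noh];
  last first.
  suff: (#|T| <= \sum_(j in T) slack j)%N by lia.
  by apply: slackT => g gT; apply: light1 => //; have := noh g; rewrite gT /= => ->.
have lightD g : g \in T :\ h -> (0 < slack g)%N.
  rewrite !inE => /andP[ngh gT]; apply: light1 => //.
  by apply: contraNN ngh => wg; rewrite (heavy1 g h).
have sT := slackT _ lightD.
have cT := cardsD1 h T; rewrite hT in cT.
have sumT : (\sum_(j in T) slack j = slack h + \sum_(j in T :\ h) slack j)%N.
  by rewrite (big_setD1 h).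
have [h0 rest0 sT' capTE] : [/\ slack h = 0%N, \sum_(j in P :\: T) slack j = 0%N,
   (\sum_(j in T :\ h) slack j <= #|T :\ h|)%N & #|Q :&: T| = #|T|].
  by split; lia.
have sTD : T \subset Q.
  have /eqP : Q :&: T == T by rewrite eqEcard subsetIr capTE leqnn.
  by move=> <-; apply: subsetIl.
have DP : Q = P by rewrite -DTP (setUidPl sTD).
have inn p : p \in P -> exists2 i, i \in P & edge D i p.
  by rewrite -{1}DP => /Qout/out_nbrsP.
have slack1 g : g \in T :\ h -> slack g = 1%N.
  move=> gT; have := sT'; rewrite (big_setD1 g) //= (cardsD1 g (T :\ h)) gT.
  have g0 := lightD g gT.
  have : (#|T :\ h :\ g| <= \sum_(j in T :\ h :\ g) slack j)%N.
    by apply: slackT => x; rewrite in_setD1 => /andP[_]; apply: lightD.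
  move: (slack g) g0 (#|_|) (\sum_(i in _) _)%N; clear; lia.
have slack0 q : q \in P :\: T -> slack q = 0%N.
  by move=> qP; move: rest0; rewrite (big_setD1 q) //=; lia.
have [q qP nqT] : exists2 q, q \in P & q \notin T.
  by apply/subsetPn; apply: contraNN nT => /packableS; apply.
have roomq v : v \in P -> slack v = 0%N -> room v = (w v).-1 /\ (1 < w v)%N.
  move=> vP; have := room_gt0 vP; have := room_ltw vP; rewrite /slack; clear; lia.
have [ah wh1] := roomq h (inP _ hT) h0.
(* half of an edge into q' and half of the pure power at h fit, unless they meet at h *)
have only_h q' : q' \in P -> q' \notin T -> forall i, i \in P -> edge D i q' -> i = h.
  move=> q'P q'T i iP eiq; apply/eqP/negPn/negP => nih.
  have nqh : q' != h by apply: contraNneq q'T => ->.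
  have niq : i != q' by apply: contraTneq eiq => ->; apply: edge_loopless.
  have [aq wq] : room q' = (w q').-1 /\ (1 < w q')%N.
    by apply: roomq => //; apply: slack0; rewrite inE q'T.
  apply: (test_in [:: (Some i, q'); (None, h)]) => //=.
    by rewrite /allowed /= q'P iP eiq hT inP.
  move=> v vP; rewrite /open_load !big_cons big_nil /= !(inj_eq Some_inj).
  move: (room_gt0 vP); clear - ah wh1 aq wq nqh niq nih.
  case: (eqVneq i v) => [<-|_].
    by rewrite ![_ == i]eq_sym (negPf nih) (negPf niq); lia.
  case: (eqVneq q' v) => [<-|_]; first by rewrite eq_sym (negPf nqh); lia.
  by case: (eqVneq h v) => [<-|_]; lia.
have [i iP eiq] := inn q qP.
have ih := only_h q qP nqT i iP eiq; subst i.
have nqh : q != h by apply: contraNneq nqT => ->.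
have [aq wq] : room q = (w q).-1 /\ (1 < w q)%N.
  by apply: roomq => //; apply: slack0; rewrite inE nqT.
(* if w h >= 3, the same two items fit although they meet at h *)
have [wh3|wh2] := leqP 3 (w h).
  apply: (test_in [:: (Some h, q); (None, h)]) => //=.
    by rewrite /allowed /= qP iP eiq hT.
  move=> v vP; rewrite /open_load !big_cons big_nil /= !(inj_eq Some_inj).
  clear - ah wh1 aq wq nqh wh3.
  case: (eqVneq h v) => [<-|_]; first by rewrite (negPf nqh); lia.
  by case: (eqVneq q v) => [<-|_]; lia.
(* now w h = 2, room h = 1, and an in-neighbour g of h supplies a third item *)
have [g gP egh] := inn h iP.
have ngh : g != h by apply: contraTneq egh => ->; apply: edge_loopless.
have ngq : g != q by apply: contraTneq egh => ->; apply: edge_oriented.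
have gT : g \in T.
  apply: contraTT egh => ngT; have [i' i'P ei'g] := inn g gP.
  by have := only_h g gP ngT i' i'P ei'g => ei'; rewrite ei' in ei'g; apply: edge_oriented.
have gTh : g \in T :\ h by rewrite !inE ngh.
have g1 := slack1 g gTh.
have lg : ~~ (w g <= 2 * room g)%N.
  by apply: contraNN ngh => wg; rewrite (heavy1 g h).
have [ag wg] : room g = 1%N /\ w g = 3.
  move: g1 lg (room_gt0 gP) (room_ltw gP); rewrite /slack; clear; lia.
apply: (test_in [:: (Some h, q); (None, h); (None, g)]) => //=.
  by rewrite /allowed /= qP iP eiq hT gT gP.
move=> v vP; rewrite /open_load !big_cons big_nil /= !(inj_eq Some_inj).
clear - ah wh1 aq wq nqh ngh ngq wh2 ag wg.
case: (eqVneq h v) => [<-|_]; first by rewrite (negPf nqh) (negPf ngh); lia.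
case: (eqVneq q v) => [<-|_]; first by rewrite (negPf ngq); lia.
by case: (eqVneq g v) => [<-|_]; lia.
Qed.
End LocalPackings.
End Packings.

(** * The families of an edge ideal and of its integral closure *)

Section Families.
Variables (n : nat) (D : weighted_oriented_graph n).
Local Notation vset := {set 'I_n}.
Local Notation w := (weight D).
Implicit Types (A B N X P T : vset) (a b : {ffun 'I_n -> int}).

(** The condition for x^a to lie in the localization at x_A of the integral closure
of the edge ideal. A negative exponent outside A is excluded since loads are
nonnegative. *)
Definition in_closure_at a A : bool :=
  `[< exists s, [/\ (0 < size s)%N, all (fun e => edge D e.1 e.2) s &
        forall v, v \notin A -> ((load D s v)%:Z <= (size s)%:Z * a v)%R] >].

(** The same for the edge ideal itself, that is with a single edge. *)
Definition in_ideal_at a A : bool :=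
  [exists i, exists j, edge D i j && [forall v in ~: A, (load D [:: (i, j)] v)%:Z <= a v]%R].

Lemma in_ideal_atP a A : reflect (exists i j, edge D i j /\
   forall v, v \notin A -> ((load D [:: (i, j)] v)%:Z <= a v)%R) (in_ideal_at a A).
Proof.
apply: (iffP existsP) => -[i].
  case/existsP=> j /andP[eij /forall_inP h]; exists i, j; split=> // v vA.
  by apply: h; rewrite inE.
case=> j [eij h]; exists i; apply/existsP; exists j; rewrite eij.
by apply/forall_inP => v; rewrite inE; apply: h.
Qed.

Lemma load_ge (s : seq ('I_n * 'I_n)) e v : e \in s ->
  ((e.1 == v) + (e.2 == v) * w v <= load D s v)%N.
Proof. by move=> es; rewrite /load (big_rem e) //= leq_addr. Qed.

Lemma load_gt0 (s : seq ('I_n * 'I_n)) e v : e \in s -> (e.1 == v) || (e.2 == v) ->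
  (0 < load D s v)%N.
Proof.
move=> es h; apply: leq_trans (load_ge v es); have := weight_gt0 D v.
by case/orP: h => /eqP->; rewrite eqxx; case: (weight D v) => // m _; lia.
Qed.

Lemma load_eq0 (s : seq ('I_n * 'I_n)) v :
  (forall e, e \in s -> (e.1 != v) && (e.2 != v)) -> load D s v = 0%N.
Proof.
move=> h; rewrite /load big_seq big1 // => e /h /andP[/negPf-> /negPf->].
by [].
Qed.

Lemma in_closure_atS a A B : A \subset B -> in_closure_at a A -> in_closure_at a B.
Proof.
move=> sAB /asboolP[s [s0 sE sv]]; apply/asboolP; exists s; split=> // v vB.
by apply: sv; apply: contra vB; apply: subsetP.
Qed.

Lemma in_ideal_atS a A B : A \subset B -> in_ideal_at a A -> in_ideal_at a B.
Proof.
move=> sAB /in_ideal_atP[i [j [eij h]]]; apply/in_ideal_atP; exists i, j; split=> // v vB.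
by apply: h; apply: contra vB; apply: subsetP.
Qed.

Lemma in_ideal_closure_at a A : in_ideal_at a A -> in_closure_at a A.
Proof.
case/in_ideal_atP=> i [j [eij h]]; apply/asboolP; exists [:: (i, j)].
by split; rewrite //= ?eij // => v /h; rewrite mul1r.
Qed.

Lemma in_closure_at_ge0 a A v : in_closure_at a A -> v \notin A -> (0 <= a v)%R.
Proof.
case/asboolP=> s [s0 _ sv] /sv; apply: contraTT; rewrite -!ltNge => av.
by apply: lt_le_trans (lez_nat 0 _); rewrite pmulr_rlt0 // ltz_nat.
Qed.

(** Each edge puts a load of at most w j on j, so a packing bounded away from j is
bounded at j. *)
Lemma in_closure_at_cone a A j : ((w j)%:Z <= a j)%R ->
  in_closure_at a (j |: A) = in_closure_at a (A :\ j).
Proof.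
move=> wa; apply/idP/idP; last first.
  by apply: in_closure_atS; apply: (subset_trans (subD1set _ _)); apply: subsetUr.
case/asboolP=> s [s0 /allP sE sv]; apply/asboolP; exists s; split=> //; first exact/allP.
move=> v; rewrite !inE negb_and negbK; case: (eqVneq v j) => [-> _|nvj /= vA].
  suff: (load D s j <= size s * w j)%N by nia.
  rewrite -sum1_size big_distrl /= /load !big_seq; apply: leq_sum => e /sE ee.
  have := weight_gt0 D j; case: (eqVneq e.1 j) => e1j; case: (eqVneq e.2 j) => e2j; try lia.
  by move: ee; rewrite e1j e2j (negPf (edge_loopless D j)).
by apply: sv; rewrite !inE negb_or nvj.
Qed.

(** All edges of a packing have both ends in A, so one of them is enough. *)
Lemma in_closure_at_nonpos a A : (forall j, a j <= 0)%R -> in_closure_at a A -> in_ideal_at a A.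
Proof.
move=> a0 fA; have := fA; case/asboolP=> s [s0 /allP sE sv].
case: s s0 sE sv => // -[i j] s _ sE sv; apply/in_ideal_atP; exists i, j.
split; first by apply: (sE (i, j)); rewrite mem_head.
move=> v vA; have := sv v vA; have l0 := load_gt0 (v := v) (mem_head (i, j) s).
have av := in_closure_at_ge0 fA vA; have := a0 v => av0 lv.
have {}av : a v = 0%R by apply/eqP; rewrite eq_le av0.
rewrite av mulr0 in lv; have {}l0 : ~~ ((i == v) || (j == v)).
  by apply/negP => /l0; rewrite ltnNge -lez_nat lv.
rewrite av load_eq0 // => e; rewrite inE => /eqP-> /=.
by rewrite -negb_or.
Qed.

Definition indep_over N (W : vset) X A :=
  [&& N \subset A, independent D A, [disjoint A & W] & [disjoint A & X]].

Definition hits P A : vset := [set q in P | [exists u in A :\: P, edge D u q]].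

Section Fixed.
Variable a : {ffun 'I_n -> int}.
Let P : vset := [set j | (0 < a j)%R].
Let N : vset := [set j | (a j < 0)%R].
Let W := out_nbrs D P.
Let room j := `|a j|%N.

Lemma roomE (s : nat) l v : (0 <= a v)%R -> ((l%:Z <= s%:Z * a v)%R = (l <= s * room v)%N).
Proof. by move=> h; rewrite -{1}(gez0_abs h) -PoszM lez_nat. Qed.

(** A packing outside A that uses neither an edge inside A nor an edge from P to A
consists of edges inside P and of edges from A to P. The tails of the latter are
inverted, except those in P: these are kept, as such a tail carries at most one
unit per item and has room for it, so they do not count as hitting. *)
Lemma in_closure_atE A : N \subset A ->
  ~~ in_closure_at a A =
  [&& independent D A, [disjoint A & W] & ~~ packable D P room (hits P A)].
Proof.
move=> /subsetP NA.
have a0 v : v \notin A -> (0 <= a v)%R.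
  by move=> vA; rewrite leNgt; apply: contra vA => ?; apply: NA; rewrite inE.
have aP v : v \notin P -> v \notin A -> a v = 0%R.
  by move=> vP /a0 av; move: vP; rewrite inE; lia.
apply/idP/and3P.
  move=> nf; split.
  - apply/independentP => i j iA jA; apply: contra nf => eij; apply/in_ideal_closure_at.
    apply/in_ideal_atP; exists i, j; split=> // v vA; rewrite load_eq0 ?a0 // => e.
    by rewrite inE => /eqP->/=; apply/andP; split; apply: contraNneq vA => <-.
  - apply: contraNT nf => /pred0Pn[j /andP[/= jA /out_nbrsP[i iP eij]]].
    apply/in_ideal_closure_at/in_ideal_atP; exists i, j; split=> // v vA.
    have njv : (j == v) = false by apply/negP => /eqP jv; rewrite -jv jA in vA.
    rewrite /load big_cons big_nil /= njv; case: eqVneq => [<-|_].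
      by move: iP; rewrite inE; lia.
    by have := a0 v vA; lia.
  - apply: contra nf => /asboolP[s [s0 /allP sl sv]]; apply/asboolP.
    (* an in-neighbour in A as the tail for each pure power *)
    pose u q := odflt q [pick u | (u \in A :\: P) && edge D u q].
    pose g (e : option 'I_n * 'I_n) := (odflt (u e.2) e.1, e.2).
    have uP q : q \in hits P A -> (u q \in A :\: P) /\ edge D (u q) q.
      rewrite inE => /andP[_ /exists_inP[x xA exq]]; rewrite /u.
      case: pickP => [y /andP[]//|/(_ x)]; by rewrite xA exq.
    exists (map g s); rewrite size_map; split=> //.
      apply/allP => _ /mapP[e /sl le ->]; rewrite /g /=.
      case: e le => [[i|] j] /andP[/= jP]; first by case/andP.
      by move=> /uP[].
    move=> v vA; have [vP|vP] := boolP (v \in P).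
      rewrite roomE ?a0 //; apply: leq_trans (sv v vP).
      rewrite /load big_map /open_load !big_seq; apply: leq_sum => e /sl.
      rewrite /g /=; case: e => [[i|] j] /andP[/= jP] //.
      move=> /uP[+ _]; case: (eqVneq (u j) v) => // ->.
      by rewrite inE (negPf vA) andbF.
    rewrite aP // mulr0 load_eq0 // => _ /mapP[e /sl + ->]; rewrite /g /=.
    case: e => [[i|] j] /andP[/= jP].
      case/andP=> iP _; apply/andP; split; apply: contraNneq vP => <- //.
    move=> /uP[]; rewrite inE => /andP[_ uA _].
    apply/andP; split; first by apply: contraNneq vA => <-.
    by apply: contraNneq vP => <-.
case=> /independentP iA dW nt; apply: contra nt => /asboolP[s [s0 /allP sE sv]].
have inW j : j \in A -> j \notin W by move=> jA; have := disjointFr dW jA => ->.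
have sP e v : e \in s -> (e.1 == v) || (e.2 == v) -> v \notin A -> v \in P.
  move=> es ev vA; have := load_gt0 es ev; have := sv v vA; rewrite inE.
  move=> lv l0; rewrite -(pmulr_rgt0 _ (_ : 0 < (size s)%:Z)%R) ?ltz_nat //.
  by apply: lt_le_trans lv; rewrite ltz_nat.
have hA e : e \in s -> e.2 \notin A.
  move=> es; apply/negP => e2A; have ee := sE e es.
  have [e1A|e1A] := boolP (e.1 \in A); first by have := iA _ _ e1A e2A; rewrite ee.
  have e1P := sP e e.1 es; rewrite eqxx in e1P.
  have /negP := inW _ e2A; apply; apply/out_nbrsP; exists e.1 => //; exact: e1P.
have hP e : e \in s -> e.2 \in P.
  by move=> es; apply: (sP e) => //; rewrite ?eqxx ?orbT ?hA.
pose g (e : 'I_n * 'I_n) := (if e.1 \in P then Some e.1 else None, e.2).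
apply/asboolP; exists (map g s); rewrite size_map; split=> //.
  apply/allP => _ /mapP[e es ->]; rewrite /allowed /g /= hP //=.
  case: ifP => [e1P|/negbT e1P]; first by rewrite e1P; exact: sE.
  rewrite inE hP //=; apply/exists_inP; exists e.1; last exact: sE.
  rewrite inE e1P /=; apply: contraNT e1P => e1A; apply: (sP e) => //.
  by rewrite eqxx.
move=> v vP.
have [vA|vA] := boolP (v \in A); last first.
  have := sv v vA; rewrite roomE ?a0 //; apply: leq_trans.
  rewrite /open_load big_map; apply: leq_sum => e _; rewrite /g /= leq_add2r.
  by case: ifP => //= _; rewrite (inj_eq Some_inj).
(* a vertex of A in P only carries tails: its in-neighbours lie neither in A nor in P *)
have room0 : (0 < room v)%N by move: vP; rewrite inE /room; lia.
apply: (leq_trans _ (leq_pmulr (size s) room0)).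
rewrite -sum1_size /open_load big_map !big_seq; apply: leq_sum => e es.
rewrite /g /=; have -> : (e.2 == v) = false.
  by apply/negP => /eqP ev; have := hA e es; rewrite ev vA.
by rewrite addn0 leq_b1.
Qed.
End Fixed.
End Families.

(** * Comparison of the two families *)

Section Comparison.
Variables (k : fieldType) (n : nat) (D : weighted_oriented_graph n).
Local Notation vset := {set 'I_n}.
Local Notation w := (weight D).
Implicit Types (A B N W X P T : vset) (a b : {ffun 'I_n -> int}).

Lemma acyclic_above i N p : p \notin N ->
  acyclic k i (fun A => N \subset A).
Proof.
move=> pN; apply: (acyclic_cone (p := p)) => A.
rewrite subsetD1 pN andbT; apply/idP/idP => [|/subset_trans]; last by apply; apply: subsetUr.
move=> /subsetP h; apply/subsetP => x xN; have := h x xN; rewrite !inE.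
by case: eqVneq => // xp; rewrite xp (negPf pN) in xN.
Qed.

Lemma convex_above N : convex (fun A => N \subset A).
Proof. by move=> A B C NA _ AB _; apply: subset_trans NA AB. Qed.

Lemma disjoint_setUr A X P :
  [disjoint A & X :|: P] = [disjoint A & X] && [disjoint A & P].
Proof. by rewrite !disjoints_subset setCU subsetI. Qed.

Lemma disjoint_set1r A v : [disjoint A & [set v]] = (v \notin A).
Proof. by rewrite disjoint_sym disjoints1. Qed.

Lemma disjoint_set0r A : [disjoint A & (finset.set0 : vset)].
Proof. by rewrite disjoint_sym disjoints_subset sub0set. Qed.

Lemma indep_overS N W X A B :
  indep_over D N W X B -> N \subset A -> A \subset B -> indep_over D N W X A.
Proof.
case/and4P=> _ /independentP iB dW dX NA AB; apply/and4P; split=> //.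
- by apply/independentP => i j /(subsetP AB) iA /(subsetP AB); apply: iB.
- exact: disjointWl AB dW.
- exact: disjointWl AB dX.
Qed.

Lemma convex_indep_over N W X : convex (indep_over D N W X).
Proof.
move=> A B C /and4P[NA _ _ _] fC AB; apply: indep_overS fC _.
exact: subset_trans NA AB.
Qed.

(** By the exact sequence for the sets that contain a vertex v of X, cohomology of
the sets that avoid v survives either without this restriction, or one degree
higher for the sets that contain v. In the second case v joins N, so that the
degree minus #|N| is preserved. *)
Lemma indep_over_restore N W X e : ~ acyclic k e (indep_over D N W X) ->
  exists N' e', [/\ N \subset N', N' \subset N :|: X, (e + #|N'| = e' + #|N|)%N &
     ~ acyclic k e' (indep_over D N' W finset.set0)].
Proof.
elim: {X}#|X| {-2}X (erefl #|X|) N e => [|m IH] X cX N e nF.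
  exists N, e; rewrite subxx subsetUl; split=> //.
  by rewrite -(cards0_eq cX).
have [v vX] : exists v, v \in X by apply/set0Pn; rewrite -cards_eq0 cX.
have cXv : #|X :\ v| = m by move: cX; rewrite (cardsD1 v) vX => -[].
have [vN|vN] := boolP (v \in N).
  case: nF; apply: acyclic_empty => A; apply/negP => /and4P[/subsetP NA _ _ dX].
  by have := disjointFr dX (NA v vN); rewrite vX.
have [|||nF'|nF'] := @nonacyclic_lower k n (indep_over D N W (X :\ v)) (fun A => v \in A) _ _ e.
- exact: convex_indep_over.
- by move=> A B vA /subsetP; apply.
- move=> aF; apply: nF; apply: acyclic_ext aF => A; rewrite /indep_over -!andbA.
  do 3!congr (_ && _).
  by rewrite -{2}(setD1K vX) disjoint_setUr disjoint_set1r andbC.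
- have [N' [e' [s1 s2 ce nF2]]] := IH _ cXv _ _ nF'; exists N', e'; split=> //.
  by apply: subset_trans s2 _; apply: setUS; apply: subD1set.
- have [|N' [e' [s1 s2 ce nF2]]] := IH _ cXv (v |: N) e.+1.
    move=> aF; apply: nF'; apply: acyclic_ext aF => A; rewrite /indep_over subUset sub1set.
    by rewrite andbC -!andbA; do ![bool_congr].
  exists N', e'; split=> //.
  + by apply: subset_trans s1; apply: subsetUr.
  + by apply: subset_trans s2 _; rewrite -setUA [N :|: _]setUC setUA setD1K // setUC.
  + by rewrite cardsU1 vN in ce; lia.
Qed.

Lemma Posz_sum (F : 'I_n -> nat) : Posz (\sum_j F j)%N = (\sum_j (F j)%:Z)%R.
Proof. exact: (big_morph Posz PoszD (erefl : Posz 0 = 0%R)). Qed.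

Section Branch.
Variables (P N W : vset) (room : 'I_n -> nat).
Local Notation packable := (packable D P room).

Definition in_nbrs (Q : vset) : vset :=
  [set u | (u \notin P) && [exists q in Q, edge D u q]].

(** The intermediate stages of the removal of the packing condition: A may not hit
the vertices of Q, and those of T are treated as hit. *)
Definition branch_family (Q T A : vset) :=
  indep_over D N W (in_nbrs Q) A && ~~ packable (hits D P A :|: T).

Lemma in_nbrs0 : in_nbrs finset.set0 = finset.set0.
Proof.
apply/setP=> u; rewrite !inE; apply/negbTE; rewrite negb_and; apply/orP; right.
by apply/exists_inP => -[x]; rewrite inE.
Qed.

Lemma hitsS A B : A \subset B -> hits D P A \subset hits D P B.
Proof.
move=> AB; apply/subsetP => q; rewrite !inE => /andP[->] /exists_inP[u uA euq] /=.
by apply/exists_inP; exists u => //; apply: subsetP uA; apply: setSD.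
Qed.

Lemma convex_branch_family (Q T : vset) : convex (branch_family Q T).
Proof.
move=> A B C /andP[fA _] /andP[fC tC] AB BC; apply/andP; split.
  exact: convex_indep_over fA fC AB BC.
by apply: contra tC; apply: packableS; apply: setSU; apply: hitsS.
Qed.

Lemma in_nbrsU1 q (Q : vset) : in_nbrs (q |: Q) = in_nbrs [set q] :|: in_nbrs Q.
Proof.
apply/setP=> u; rewrite !inE -andb_orr; congr (_ && _).
apply/exists_inP/orP => [[x]|].
  rewrite !inE => /orP[/eqP->|xQ] eux; [left|right]; apply/exists_inP.
    by exists q; rewrite ?inE.
  by exists x.
case=> /exists_inP[x xQ eux]; exists x => //; rewrite inE ?xQ ?orbT //.
Qed.

Lemma hits_in_nbrs A q : q \in P ->
  (q \in hits D P A) = ~~ [disjoint A & in_nbrs [set q]].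
Proof.
move=> qP; rewrite inE qP /=; apply/exists_inP/pred0Pn => -[u].
  rewrite inE => /andP[uP uA] euq; exists u; rewrite /= uA !inE uP.
  by apply/exists_inP; exists q; rewrite ?inE.
move=> /= /andP[uA]; rewrite inE => /andP[uP /exists_inP[q' ]].
by rewrite inE => /eqP-> euq; exists u; rewrite // inE uP.
Qed.

Lemma branch_familyU1 q (Q T A : vset) : q \in P ->
  branch_family (q |: Q) T A = branch_family Q T A && ~~ (q \in hits D P A).
Proof.
move=> qP; rewrite /branch_family /indep_over hits_in_nbrs // negbK in_nbrsU1.
rewrite [in RHS]andbAC; congr (_ && _); rewrite -!andbA; do 3!congr (_ && _).
by rewrite disjoint_setUr andbC.
Qed.

Lemma branch_family_hit q (Q T A : vset) :
  (branch_family Q T A && (q \in hits D P A)) =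
  (branch_family Q (q |: T) A && (q \in hits D P A)).
Proof.
rewrite /branch_family; case: (boolP (q \in _)) => [qh|]; rewrite ?andbF ?andbT //.
by rewrite setUA (_ : hits D P A :|: [set q] = hits D P A) //; apply/setUidPl; rewrite sub1set.
Qed.

(** The sets that hit q form an upward closed part, on which declaring q hit changes
nothing; the sets that do not hit q form the family of q |: Q. Hence cohomology
survives with q added to Q, or with q added to T, or with q added to both and one
degree lower, and #|Q :&: T| counts the lost degrees. *)
Lemma branch_family_resolve (Q T : vset) e : Q \subset P -> T \subset P ->
  ~ acyclic k e (branch_family Q T) ->
  exists Q' T' e', [/\ Q' :|: T' = P, (e + #|Q :&: T| = e' + #|Q' :&: T'|)%N &
     ~ acyclic k e' (branch_family Q' T')].
Proof.
elim: {Q T}#|P :\: (Q :|: T)| {-2}Q {-2}T (erefl #|P :\: (Q :|: T)|) e =>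
  [|m IH] Q T cm e QP TP nF.
  exists Q, T, e; split=> //; apply/eqP; rewrite eqEsubset subUset QP TP /=.
  by rewrite -setD_eq0 -cards_eq0 cm.
have [q] : exists q, q \in P :\: (Q :|: T) by apply/set0Pn; rewrite -cards_eq0 cm.
rewrite !inE negb_or => /andP[/andP[qQ qT] qP].
have card_step : #|P :\: (q |: (Q :|: T))| = m.
  move: cm; rewrite (cardsD1 q) !inE negb_or qQ qT qP => -[<-].
  by congr #|pred_of_set _|; rewrite setDDl setUC.
have qPs X : X \subset P -> q |: X \subset P by move=> XP; rewrite subUset sub1set qP.
pose Qh A := q \in hits D P A.
have Qh_up A B : Qh A -> A \subset B -> Qh B by move=> h /hitsS/subsetP; apply.
have [nF1|nF2] := nonacyclic_cut (@convex_branch_family Q T) Qh_up nF; last first.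
  have [||||Q' [T' [e' [PE ce nF']]]] := IH (q |: Q) T _ e => //.
  - by rewrite -setUA.
  - exact: qPs.
  - by move=> aF; apply: nF2; apply: acyclic_ext aF => A; rewrite branch_familyU1.
  exists Q', T', e'; split=> //; rewrite -ce; congr (_ + #|pred_of_set _|).
  rewrite setIUl (_ : [set q] :&: T = finset.set0) ?set0U //.
  by apply/setP=> x; rewrite !inE; case: eqVneq => // ->; rewrite (negPf qT).
have {}nF1 : ~ acyclic k e (fun A => branch_family Q (q |: T) A && Qh A).
  by move=> aF; apply: nF1; apply: acyclic_ext aF => A; symmetry; apply: branch_family_hit.
have [nF'|[e' ee' nF']] := nonacyclic_upper (@convex_branch_family Q (q |: T)) Qh_up nF1.
  have [||||Q' [T' [e' [PE ce nF'']]]] := IH Q (q |: T) _ e => //.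
  - by rewrite setUCA.
  - exact: qPs.
  exists Q', T', e'; split=> //; rewrite -ce; congr (_ + #|pred_of_set _|).
  rewrite setIUr (_ : Q :&: [set q] = finset.set0) ?set0U //.
  by apply/setP=> x; rewrite !inE; case: eqVneq => [->|_]; rewrite ?(negPf qQ) ?andbF.
have [||||Q' [T' [e'' [PE ce nF'']]]] := IH (q |: Q) (q |: T) _ e' => //.
- by rewrite setUACA setUid.
- exact: qPs.
- exact: qPs.
- by move=> aF; apply: nF'; apply: acyclic_ext aF => A; rewrite branch_familyU1.
exists Q', T', e''; split=> //; move: ce.
by rewrite -setUIr cardsU1 !inE negb_and qQ /= ee'; lia.
Qed.
End Branch.

(** A vertex q of P without in-neighbour in P is isolated once its in-neighbours
outside P are forbidden. *)
Lemma indep_over_cone i N P (Q : vset) q : q \in P -> q \notin N -> q \in Q ->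
  q \notin out_nbrs D P ->
  acyclic k i (indep_over D N (out_nbrs D P) (in_nbrs P Q)).
Proof.
move=> qP qN qQ qW.
apply: (acyclic_cone (p := q)) => A; apply/idP/idP => [fA|].
  have [NA _ _ _] := and4P fA; apply: indep_overS fA _ _.
    rewrite subsetD1 qN andbT; apply/subsetP => x xN.
    have := subsetP NA x xN; rewrite !inE; case: eqVneq => // xq.
    by rewrite -xq xN in qN.
  by apply: (subset_trans (subD1set _ _)); apply: subsetUr.
case/and4P=> NA /independentP iA dW dX.
have Aq x : x \in q |: A -> x != q -> x \in A :\ q.
  by rewrite !inE => /orP[->|->] // ->.
apply/and4P; split.
- by apply: (subset_trans NA); apply: (subset_trans (subD1set _ _)); apply: subsetUr.
- apply/independentP => x y.
  case: (eqVneq x q) => [-> _|xq xA]; case: (eqVneq y q) => [-> _|yq yA].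
  + exact: edge_loopless.
  + apply: contraFN (disjointFr dW (Aq y yA yq)) => eqy.
    by apply/out_nbrsP; exists q.
  + apply: contraFN (disjointFr dX (Aq x xA xq)) => exq.
    rewrite inE; apply/andP; split; last by apply/exists_inP; exists q.
    by apply: contra qW => xP; apply/out_nbrsP; exists x.
  + by apply: iA; apply: Aq.
- apply/pred0P => x /=; case: (eqVneq x q) => [->|xq]; first by rewrite (negPf qW) andbF.
  by apply/negP => /andP[xA xW]; have := disjointFr dW (Aq x xA xq); rewrite xW.
- apply/pred0P => x /=; case: (eqVneq x q) => [->|xq].
    by rewrite [_ \in in_nbrs _ _]inE qP andbF.
  by apply/negP => /andP[xA xW]; have := disjointFr dX (Aq x xA xq); rewrite xW.
Qed.

(** Once no vertex of Q can be hit, the packing condition is a constant. *)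
Lemma branch_family_resolved i P N W room (Q T : vset) : Q :|: T = P ->
  ~ acyclic k i (branch_family P N W room Q T) ->
  ~~ packable D P room T /\ ~ acyclic k i (indep_over D N W (in_nbrs P Q)).
Proof.
move=> QT nF.
have nT : ~~ packable D P room T.
  apply/negP => tT; apply: nF; apply: acyclic_empty => A; apply/negP => /andP[_ /negP[]].
  by apply: packableS tT; apply: subsetUr.
have hitsQ A : indep_over D N W (in_nbrs P Q) A -> hits D P A \subset T.
  case/and4P=> _ _ _ dX; apply/subsetP => q qh.
  have qP : q \in P by move: qh; rewrite inE => /andP[].
  move: (qP); rewrite -{1}QT inE => /orP[qQ|//].
  move: qh; rewrite hits_in_nbrs // => /negP[].
  apply: disjointWr dX; apply/subsetP => u; rewrite !inE => /andP[-> /exists_inP[x]].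
  by rewrite inE => /eqP-> euq; apply/exists_inP; exists q.
split=> // aF; apply: nF; apply: acyclic_ext aF => A; rewrite /branch_family.
case: (boolP (indep_over _ _ _ _ _)) => //= fA; symmetry.
by rewrite (setUidPr (hitsQ A fA)).
Qed.
(** The degree of the edge ideal in which cohomology is found: w j - 1 is the largest
exponent on P that creates no power x_j ^ w j. *)
Definition witness_degree P N : {ffun 'I_n -> int} :=
  [ffun j => if j \in P then (w j).-1%:Z else if j \in N then -1 else 0]%R.

Section Witness.
Variables (P N : vset).
Hypothesis P_notN : forall j, j \in P -> j \notin N.
Hypothesis w_gt1 : forall j, j \in P -> (1 < w j)%N.
Let b := witness_degree P N.

Lemma witness_degreeE j : b j = (((j \in P) * (w j).-1)%N%:Z - (j \in N)%:Z)%R.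
Proof.
rewrite /b ffunE; case: (boolP (j \in P)) => [/P_notN/negPf->|_].
  by rewrite mul1n subr0.
by case: (j \in N).
Qed.

Lemma witness_degree_above A : in_ideal_at D b A -> N \subset A.
Proof.
move=> /in_ideal_closure_at fA; apply/subsetP => v vN; apply: contraTT isT => vA.
have := in_closure_at_ge0 fA vA; rewrite witness_degreeE vN.
by rewrite (_ : v \in P = false) //; apply: contraTF vN => /P_notN.
Qed.

Lemma in_ideal_at_witness A : N \subset A ->
  ~~ in_ideal_at D b A = indep_over D N (out_nbrs D P) finset.set0 A.
Proof.
move=> /subsetP NA.
have b_ge0 v : v \notin A -> (0 <= b v)%R.
  move=> vA; have /negPf vN : v \notin N by apply: contra vA; apply: NA.
  by rewrite witness_degreeE vN subr0.
apply/idP/idP.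
  move=> ne; apply/and4P; split; [exact/subsetP| | |exact: disjoint_set0r].
    apply/independentP => i j iA jA; apply: contra ne => eij.
    apply/in_ideal_atP; exists i, j; split=> // v vA; rewrite load_eq0 ?b_ge0 // => x.
    by rewrite inE => /eqP->/=; apply/andP; split; apply: contraNneq vA => <-.
  apply: contraNT ne => /pred0Pn[j /andP[/= jA /out_nbrsP[i iP eij]]].
  apply/in_ideal_atP; exists i, j; split=> // v vA.
  have njv : (j == v) = false by apply/negP => /eqP jv; rewrite -jv jA in vA.
  rewrite /load big_cons big_nil /= njv; case: eqVneq => [<-|_].
    by rewrite witness_degreeE iP (negPf (P_notN iP)); move: (w_gt1 iP); clear; lia.
  by move: (b_ge0 v vA); clear; lia.
case/and4P=> _ /independentP iA dW _; apply/negP => /in_ideal_atP[i [j [eij h]]].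
have jA : j \in A.
  apply: contraT => /h; rewrite witness_degreeE /load big_cons big_nil /= eqxx.
  by move: (weight_gt0 D j); case: (_ \in P); case: (_ \in N); clear; lia.
have niA : i \notin A by apply/negP => /iA/(_ jA); rewrite eij.
have := h i niA; rewrite /load big_cons big_nil /= eqxx witness_degreeE.
have [iP _|_] := boolP (i \in P); last by case: (_ \in N); clear; lia.
have jW : j \in out_nbrs D P by apply/out_nbrsP; exists i.
by have := disjointFr dW jA; rewrite jW.
Qed.

Lemma witness_degree_nonacyclic e p : p \in P ->
  ~ acyclic k e (indep_over D N (out_nbrs D P) finset.set0) ->
  ~ acyclic k e.+1 (in_ideal_at D b).
Proof.
move=> pP nF.
have [nab|nE] : ~ acyclic k e (fun A => N \subset A) \/
    ~ acyclic k e.+1 (fun A => (N \subset A) && in_ideal_at D b A).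
  apply: nonacyclic_lower.
  - exact: convex_above.
  - by move=> A B fA AB; apply: in_ideal_atS fA.
  - move=> aF; apply: nF; apply: acyclic_ext aF => A.
    case: (boolP (N \subset A)) => /= [/in_ideal_at_witness->//|nNA].
    by symmetry; apply/negbTE; apply: contra nNA => /and4P[].
  by case: nab; apply: acyclic_above (P_notN pP).
move=> aF; apply: nE; apply: acyclic_ext aF => A.
by case: (boolP (in_ideal_at D b A)) => [/witness_degree_above->|]; rewrite ?andbF.
Qed.

Lemma sum_witness_degree :
  (\sum_j b j = (\sum_(j in P) (w j).-1)%N%:Z - #|N|%:Z)%R.
Proof.
rewrite -sum1_card ![(\sum_(_ in _) _)%N]big_mkcond /= !Posz_sum -sumrB.
apply: eq_bigr => j _.
by rewrite witness_degreeE; case: (_ \in P); case: (_ \in N); rewrite ?mul1n.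
Qed.
End Witness.

Theorem in_ideal_at_dominates a i : ~ acyclic k i (in_closure_at D a) ->
  exists b i', ~ acyclic k i' (in_ideal_at D b) /\
    (i%:Z + \sum_j a j <= i'%:Z + \sum_j b j)%R.
Proof.
move=> na.
have aw j : (a j < (w j)%:Z)%R.
  rewrite ltNge; apply/negP => wa; apply: na; apply: (acyclic_cone (p := j)) => A.
  exact: in_closure_at_cone.
pose P : vset := [set j | (0 < a j)%R].
pose N : vset := [set j | (a j < 0)%R].
pose W := out_nbrs D P.
pose room j := `|a j|%N.
case: (set_0Vmem P) => [P0|[p pP]].
  exists a, i; split=> // aI; apply: na; apply: acyclic_ext aI => A.
  apply/idP/idP; first exact: in_ideal_closure_at.
  by apply: in_closure_at_nonpos => j; have := in_set0 j; rewrite -P0 inE; lia.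
have P_notN j : j \in P -> j \notin N by rewrite !inE -leNgt => /ltW.
have room_gt0 j : j \in P -> (0 < room j)%N by rewrite inE /room; lia.
have room_ltw j : j \in P -> (room j < w j)%N by rewrite inE /room; have := aw j; lia.
have closure_above A : in_closure_at D a A -> N \subset A.
  move=> fA; apply/subsetP => v; rewrite inE; apply: contraTT => /(in_closure_at_ge0 fA).
  by rewrite -leNgt.
(* the degree lost on the way, i - e.+1, has to be covered by the slack *)
have finish e Q : ~ acyclic k e (indep_over D N W (in_nbrs P Q)) ->
    (i <= e.+1 + \sum_(j in P) slack D room j)%N ->
    exists b i', ~ acyclic k i' (in_ideal_at D b) /\
      (i%:Z + \sum_j a j <= i'%:Z + \sum_j b j)%R.
  move=> nF ile; have [N' [e' [NN' N'NX ce nF']]] := indep_over_restore nF.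
  have P_notN' j : j \in P -> j \notin N'.
    move=> jP; apply/negP => /(subsetP N'NX); rewrite in_setU => /orP[|].
      by rewrite (negPf (P_notN j jP)).
    by rewrite inE jP.
  have w_gt1 j : j \in P -> (1 < w j)%N.
    by move=> jP; apply: leq_ltn_trans (room_gt0 j jP) (room_ltw j jP).
  exists (witness_degree P N'), e'.+1; split.
    exact: witness_degree_nonacyclic pP nF'.
  have suma : (\sum_j a j <= (\sum_(j in P) room j)%N%:Z - #|N|%:Z)%R.
    rewrite -sum1_card ![(\sum_(_ in _) _)%N]big_mkcond /= !Posz_sum -sumrB.
    by apply: ler_sum => j _; rewrite !inE /room; case: (ltrgt0P (a j)); lia.
  have sums : (\sum_(j in P) (w j).-1 =
      \sum_(j in P) room j + \sum_(j in P) slack D room j)%N.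
    rewrite -big_split /=; apply: eq_bigr => j jP; have := room_ltw j jP.
    by rewrite /slack; clear; lia.
  rewrite sum_witness_degree // sums; move: suma ile ce; clear.
  move: (\sum_j a j)%R (\sum_(j in P) room j)%N (\sum_(j in P) _)%N #|N| #|N'|.
  lia.
have [nab|[e ie nK]] : ~ acyclic k i (fun A => N \subset A) \/
    exists2 e, i = e.+1 & ~ acyclic k e (fun A => (N \subset A) && ~~ in_closure_at D a A).
  apply: nonacyclic_upper.
  - exact: convex_above.
  - by move=> A B fA AB; apply: in_closure_atS fA.
  - move=> aF; apply: na; apply: acyclic_ext aF => A.
    by case: (boolP (in_closure_at D a A)) => [/closure_above->|]; rewrite ?andbF.
  by case: nab; apply: acyclic_above (P_notN p pP).
have [tP|tP] := boolP (packable D P room P); last first.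
  (* nothing is packable: the packing condition is void *)
  apply: (finish e finset.set0); last by rewrite ie leq_addr.
  move=> aF; apply: nK; apply: acyclic_ext aF => A; rewrite /indep_over.
  case: (boolP (N \subset A)) => //= NA; rewrite in_closure_atE //.
  congr [&& _, _ & _]; rewrite in_nbrs0 disjoint_set0r; symmetry.
  by apply: contra tP; apply: packableS; apply/subsetP => x; rewrite inE => /andP[].
have {}nK : ~ acyclic k e (branch_family P N W room finset.set0 finset.set0).
  move=> aF; apply: nK; apply: acyclic_ext aF => A.
  rewrite /branch_family /indep_over setU0 in_nbrs0 disjoint_set0r andbT.
  by case: (boolP (N \subset A)) => //= NA; rewrite in_closure_atE // -!andbA.
have [Q [T [e' [QT ce nF]]]] := branch_family_resolve (sub0set P) (sub0set P) nK.
rewrite set0I cards0 addn0 in ce.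
have [nT {}nF] := branch_family_resolved QT nF.
have QP : Q \subset P by rewrite -QT subsetUl.
apply: (finish e' Q) => //.
have Qout q : q \in Q -> q \in W.
  move=> qQ; apply: contraT => qW; exfalso; apply: nF.
  have qP := subsetP QP q qQ; exact: indep_over_cone qP (P_notN q qP) qQ qW.
have := slack_bound room_gt0 room_ltw QT Qout nT tP.
by rewrite ie ce addSn ltnS leq_add2l.
Qed.
End Comparison.

(** * Comparable terms in sequences of vectors *)

Section Dickson.

Lemma nondecreasing_subseq (u : nat -> nat) : exists h : nat -> nat,
  {homo h : i j / (i < j)%N} /\ {homo u \o h : i j / (i <= j)%N}.
Proof.
(* the k-th index is chosen so that u is minimal on all later indices *)
have tail_min N : exists i, (N <= i)%N /\ forall j, (N <= j)%N -> (u i <= u j)%N.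
  pose Q v := `[< exists2 i, (N <= i)%N & u i = v >].
  have exQ : exists v, Q v by exists (u N); apply/asboolP; exists N.
  case: (ex_minnP exQ) => v /asboolP[i Ni <-] vmin; exists i; split=> // j Nj.
  by apply: vmin; apply/asboolP; exists j.
have [phi phiP] := choice tail_min.
pose h := fix h k := if k is k'.+1 then phi (h k').+1 else phi 0%N.
have hS k : (h k < h k.+1)%N by have [] := phiP (h k).+1.
have hlt : {homo h : i j / (i < j)%N} by apply: homo_ltn hS; apply: ltn_trans.
exists h; split=> //; apply: homo_leq; [exact: leqnn|exact: leq_trans|].
case=> [|k] /=.
  by have [_] := phiP 0%N; apply.
have [_] := phiP (h k).+1; apply; apply: ltn_trans (hS k) (hS k.+1).
Qed.

(** Dickson's lemma. *)
Lemma dickson (T : finType) (F : nat -> T -> nat) :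
  exists i j, (i < j)%N /\ forall t, (F i t <= F j t)%N.
Proof.
suff [g [gS gP]] : exists g : nat -> nat, {homo g : i j / (i < j)%N} /\
    forall t, t \in enum T -> {homo (fun k => F (g k) t) : i j / (i <= j)%N}.
  exists (g 0%N), (g 1%N); split; first exact: gS.
  by move=> t; apply: (gP t) => //; rewrite mem_enum.
elim: (enum T) => [|t r [g [gS gP]]]; first by exists id; split.
have [h [hS hP]] := nondecreasing_subseq (fun k => F (g k) t).
exists (g \o h); split; first by move=> i j /hS/gS.
move=> x; rewrite inE => /orP[/eqP->|xr]; first exact: hP.
move=> i j ij /=; apply: (gP x xr); move: ij; rewrite leq_eqVlt.
by case/orP=> [/eqP->//|/hS/ltnW].
Qed.
End Dickson.



(** * Powers of an ideal and integral closure *)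

Local Open Scope ring_scope.

Section IdealSpan.
Variable R : comNzRingType.
Implicit Types (G I : set R) (x y c : R).

Lemma ideal_span0 G : ideal_span G 0.
Proof. by exists 0%N, (fun=> 0), (fun=> 0); split=> [[]|]; rewrite ?big_ord0. Qed.

Lemma ideal_span_gen G x : G x -> ideal_span G x.
Proof. by move=> Gx; exists 1%N, (fun=> 1), (fun=> x); rewrite big_ord1 mul1r. Qed.

Lemma ideal_spanM G c x : ideal_span G x -> ideal_span G (c * x).
Proof.
move=> [m [e [g [Gg ->]]]]; exists m, (fun i => c * e i), g; split=> //.
by rewrite mulr_sumr; apply: eq_bigr => i _; rewrite mulrA.
Qed.

Lemma ideal_spanD G x y : ideal_span G x -> ideal_span G y -> ideal_span G (x + y).
Proof.
move=> [m [e [g [Gg ->]]]] [m' [e' [g' [Gg' ->]]]].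
pose F T (u : 'I_m -> T) (u' : 'I_m' -> T) (i : 'I_(m + m')) :=
  match split i with inl j => u j | inr j => u' j end.
exists (m + m')%N, (F _ e e'), (F _ g g'); split.
  by move=> i; rewrite /F; case: split.
rewrite big_split_ord /=; congr (_ + _); apply: eq_bigr => i _; rewrite /F.
  by rewrite -[lshift _ _]/(unsplit (inl _)) unsplitK.
by rewrite -[rshift _ _]/(unsplit (inr _)) unsplitK.
Qed.

Lemma ideal_span_sum (T : Type) (r : seq T) (P : pred T) (F : T -> R) G :
  (forall i, P i -> ideal_span G (F i)) -> ideal_span G (\sum_(i <- r | P i) F i).
Proof.
move=> GF; elim/big_rec: _ => [|i x Pi]; first exact: ideal_span0.
by apply: ideal_spanD; apply: GF.
Qed.

Lemma ideal_span_min G (Q : R -> Prop) x :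
  Q 0 -> (forall x y, Q x -> Q y -> Q (x + y)) -> (forall c x, Q x -> Q (c * x)) ->
  (forall x, G x -> Q x) -> ideal_span G x -> Q x.
Proof.
move=> Q0 QD QM GQ [m [e [g [Gg ->]]]]; elim/big_ind: _ => // i _.
by apply: QM; apply: GQ.
Qed.

Lemma ideal_exp0 I x : ideal_exp I 0 x.
Proof.
rewrite -[x]mulr1; apply: ideal_spanM; apply: ideal_span_gen.
by exists (fun=> 0); split=> [[]|]; rewrite ?big_ord0.
Qed.

Lemma ideal_exp1 I x : I x -> ideal_exp I 1 x.
Proof. by move=> Ix; apply: ideal_span_gen; exists (fun=> x); rewrite big_ord1. Qed.

Lemma ideal_expM I i j x y :
  ideal_exp I i x -> ideal_exp I j y -> ideal_exp I (i + j) (x * y).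
Proof.
move=> + Iy; apply: (ideal_span_min (Q := fun u => ideal_exp I (i + j) (u * y))).
- by rewrite mul0r; apply: ideal_span0.
- by move=> u v; rewrite mulrDl; apply: ideal_spanD.
- by move=> c u; rewrite -mulrA; apply: ideal_spanM.
move=> _ [g [Ig ->]]; move: Iy.
apply: (ideal_span_min (Q := fun u => ideal_exp I (i + j) (_ * u))).
- by rewrite mulr0; apply: ideal_span0.
- by move=> u v; rewrite mulrDr; apply: ideal_spanD.
- by move=> c u; rewrite mulrCA; apply: ideal_spanM.
move=> _ [g' [Ig' ->]]; apply: ideal_span_gen.
pose h (l : 'I_(i + j)) := match split l with inl a => g a | inr b => g' b end.
exists h; split; first by move=> l; rewrite /h; case: split.
rewrite big_split_ord /=; congr (_ * _); apply: eq_bigr => l _; rewrite /h.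
  by rewrite -[lshift _ _]/(unsplit (inl _)) unsplitK.
by rewrite -[rshift _ _]/(unsplit (inr _)) unsplitK.
Qed.

Lemma ideal_exp_leq I i j x : (i <= j)%N -> ideal_exp I j x -> ideal_exp I i x.
Proof.
move=> /subnKC <-; apply: (ideal_span_min (Q := ideal_exp I i));
  [exact: ideal_span0|exact: ideal_spanD|exact: ideal_spanM|].
move=> _ [g [Ig ->]]; rewrite big_split_ord /= mulrC; apply: ideal_spanM.
by apply: ideal_span_gen; eexists; split; last reflexivity.
Qed.

(** The Rees algebra is the set of the polynomials whose coefficient of degree j lies
in I ^ j. Integrality of f over I is integrality of f X over it, and integral
elements over a ring are known to be closed under sums and products. *)
Section Rees.
Variable I : set R.

Definition rees_mem : {pred {poly R}} := fun p => `[< forall j, ideal_exp I j p`_j >].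

Lemma rees_memP (p : {poly R}) : reflect (forall j, ideal_exp I j p`_j) (p \in rees_mem).
Proof. exact: asboolP. Qed.

Fact rees_subring : subring_closed rees_mem.
Proof.
split.
- apply/rees_memP => -[|j]; rewrite coef1; first exact: ideal_exp0.
  exact: ideal_span0.
- move=> p q /rees_memP pI /rees_memP qI; apply/rees_memP => j; rewrite coefB.
  apply: ideal_spanD; first exact: pI.
  by rewrite -mulN1r; apply: ideal_spanM; apply: qI.
- move=> p q /rees_memP pI /rees_memP qI; apply/rees_memP => j; rewrite coefM.
  apply: ideal_span_sum => i _; have ij : (i <= j)%N by rewrite -ltnS.
  by have := ideal_expM (pI i) (qI (j - i)%N); rewrite subnKC.
Qed.

HB.instance Definition _ := GRing.isSubringClosed.Build {poly R} rees_mem rees_subring.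

Record rees := Rees { rees_val : {poly R}; _ : rees_val \in rees_mem }.
HB.instance Definition _ := [isSub for rees_val].
HB.instance Definition _ := [Choice of rees by <:].
HB.instance Definition _ := [SubChoice_isSubComNzRing of rees by <:].

(** In one direction the coefficients a i of the equation become a i X ^ i; in the
other one the coefficient of degree d of the equation is extracted. The Rees
algebra is kept abstract, as the source of an embedding phi, so that conversion
does not unfold its construction. *)
Lemma integral_closure_overring (A : comNzRingType) (phi : {rmorphism A -> {poly R}})
    (psi : {poly R} -> A) (f : R) :
  (forall u : A, phi u \in rees_mem) -> {in rees_mem, cancel psi phi} ->
  integral_closure I f <-> integralOver phi (f *: 'X).
Proof.
move=> phiP psiK; split.
  move=> [d [a [d0 aI eq0]]].
  pose c i := psi (a i *: 'X^i).
  have cE i : (1 <= i <= d)%N -> phi (c i) = a i *: 'X^i.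
    move=> /aI Ii; apply: psiK; apply/rees_memP => j.
    rewrite coefZ coefXn; case: eqP => [->|_]; first by rewrite mulr1.
    by rewrite mulr0; apply: ideal_span0.
  pose q := \sum_(1 <= i < d.+1) (c i)%:P * 'X^(d - i).
  have sq : (size q <= d)%N.
    apply: (leq_trans (size_sum _ _ _)); apply/bigmax_leqP_seq => i.
    rewrite mem_index_iota => /andP[i1 id] _.
    apply: (leq_trans (size_mul_leq _ _)); rewrite size_polyXn addnS /=.
    by apply: (leq_trans (leq_add (size_polyC_leq1 _) (leqnn _))); lia.
  exists ('X^d + q).
    by rewrite monicE lead_coefDl ?lead_coefXn // size_polyXn ltnS.
  rewrite rmorphD /= map_polyXn /q rmorph_sum /=; apply/eqP.
  rewrite hornerD hornerXn horner_sum exprZn.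
  rewrite (eq_big_nat _ _ (F2 := fun i => (a i * f ^+ (d - i)) *: 'X^d)).
    by rewrite -scaler_suml -scalerDl eq0 scale0r.
  move=> i /andP[i1 id]; rewrite rmorphM /= map_polyC /= map_polyXn hornerM hornerC hornerXn.
  by rewrite cE ?i1 // exprZn -scalerAl -scalerAr scalerA -exprD subnKC.
move=> [p mp /eqP]; set d := (size p).-1.
have sp : size p = d.+1 by rewrite /d prednK // size_poly_gt0 monic_neq0.
have sp' : (size (map_poly phi p) <= d.+1)%N
  by rewrite -sp size_map_poly_id0 // (monicP mp) rmorph1 oner_neq0.
rewrite (horner_coef_wide _ sp') big_ord_recr /=.
pose a i := (phi p`_(d - i))`_i.
move=> /(congr1 (fun q : {poly R} => q`_d)); rewrite coef0 coefD coef_sum.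
have coefT i (q : {poly R}) : (i <= d)%N -> (q * (f *: 'X) ^+ i)`_d = q`_(d - i) * f ^+ i.
  by move=> id; rewrite exprZn -scalerAr coefZ coefMXn ltnNge id /= mulrC.
rewrite coefT // subnn coef_map /= [p`_d](_ : _ = lead_coef p) // (monicP mp).
rewrite rmorph1 coef1 mul1r => eq0.
have d0 : (0 < d)%N.
  rewrite lt0n; apply: contra_eqN eq0 => /eqP->; rewrite big_ord0 add0r expr0.
  exact: oner_neq0.
exists d, a; split=> //.
  move=> i _; exact: (rees_memP _ (phiP _)).
rewrite -[RHS]eq0 addrC; congr (_ + _).
rewrite -(big_mkord xpredT (fun i => ((map_poly phi p)`_i * (f *: 'X) ^+ i)`_d)).
rewrite big_nat_rev big_add1 /=; apply: eq_big_nat => i /andP[_ id].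
by rewrite add1n !subSS coefT ?(ltnW id) // coef_map /= /a subKn // ltnW.
Qed.

Definition rees_hom : {rmorphism rees -> {poly R}} := (val : rees -> {poly R}).

Lemma integral_closure_rees f :
  integral_closure I f <-> integralOver rees_hom (f *: 'X).
Proof.
apply: (@integral_closure_overring _ rees_hom (insubd 0)) => [x|q qI].
  exact: (valP x).
by rewrite /= -/(val _) insubdK.
Qed.

Lemma integral_closureB f g :
  integral_closure I f -> integral_closure I g -> integral_closure I (f - g).
Proof.
move=> /integral_closure_rees If /integral_closure_rees Ig.
by apply/integral_closure_rees; rewrite scalerBl; apply: integral_sub.
Qed.

Lemma integral_closureM c f : integral_closure I f -> integral_closure I (c * f).
Proof.
move=> /integral_closure_rees If; apply/integral_closure_rees.
have cI : c%:P \in rees_mem.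
  apply/rees_memP => -[|j]; rewrite coefC /=; first exact: ideal_exp0.
  exact: ideal_span0.
rewrite -scalerA -mul_polyC; apply: integral_mul => //.
by rewrite -[c%:P]/(rees_hom (Rees cI)); apply: integral_id.
Qed.

Lemma integral_closure0 : integral_closure I 0.
Proof.
by apply/integral_closure_rees; rewrite scale0r; apply: integral0.
Qed.

Lemma integral_closureD f g :
  integral_closure I f -> integral_closure I g -> integral_closure I (f + g).
Proof.
move=> If Ig; rewrite -[g]opprK; apply: integral_closureB => //.
by rewrite -sub0r; apply: integral_closureB integral_closure0 Ig.
Qed.

Lemma integral_closure_expr f d : (0 < d)%N -> ideal_exp I d (f ^+ d) ->
  integral_closure I f.
Proof.
move=> d0 Ifd; exists d, (fun i => if i == d then - f ^+ d else 0); split=> //.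
  move=> i _; case: eqP => [->|_]; last exact: ideal_span0.
  by rewrite -mulN1r; apply: ideal_spanM.
rewrite big_nat_recr //= eqxx subnn expr0 mulr1 big_nat big1 ?add0r ?subrr //.
by move=> i /andP[_ id]; rewrite ltn_eqF ?mul0r.
Qed.

(** With d the degree of the equation of f, multiply the equation by c f ^ (N - d)
and induct on N; for N <= d the factor c is enough. *)
Lemma integral_closure_powers f : integral_closure I f ->
  exists d, forall c, ideal_exp I d c -> forall N, ideal_exp I N (c * f ^+ N).
Proof.
move=> [d [a [d0 aI eq0]]]; exists d => c Ic; elim/ltn_ind => N IH.
have [Nd|dN] := leqP N d.
  by rewrite mulrC; apply: ideal_spanM; apply: ideal_exp_leq Ic.
have -> : c * f ^+ N = - \sum_(1 <= i < d.+1) a i * (c * f ^+ (N - i)).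
  rewrite -(subnKC (ltnW dN)) exprD.
  move/eqP: eq0; rewrite addr_eq0 => /eqP->.
  rewrite mulNr mulrN mulr_suml mulr_sumr; congr (- _); apply: eq_big_nat => i.
  move=> /andP[_ id]; rewrite -addnBAC //.
  by rewrite exprD !mulrA [c * a i]mulrC.
rewrite -mulN1r; apply: ideal_spanM; rewrite big_nat; apply: ideal_span_sum => i.
move=> /andP[i1 id]; have iN : (i <= N)%N by apply: leq_trans (ltnW dN).
have := ideal_expM (aI i _) (IH (N - i)%N _).
by rewrite subnKC // i1; apply=> //; lia.
Qed.
End Rees.
End IdealSpan.

(** * Monomials in the edge ideal and in its integral closure *)

Section MonomialMembership.
Variables (k : fieldType) (n : nat) (D : weighted_oriented_graph n).
Local Notation w := (weight D).
Local Notation edges := (all (fun e => edge D e.1 e.2)).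
Local Notation I := (edge_ideal k D).
Implicit Types (f h : {mpoly k[n]}) (m : 'X_{1..n}) (s : seq ('I_n * 'I_n)).

Definition mload s : 'X_{1..n} := [multinom load D s v | v < n].

Lemma load_cat s1 s2 v : load D (s1 ++ s2) v = (load D s1 v + load D s2 v)%N.
Proof. by rewrite /load big_cat. Qed.

Lemma load_perm s1 s2 v : perm_eq s1 s2 -> load D s1 v = load D s2 v.
Proof. by move=> p12; rewrite /load (perm_big _ p12). Qed.

Lemma mload_cat s1 s2 : mload (s1 ++ s2) = (mload s1 + mload s2)%MM.
Proof. by apply/mnmP => v; rewrite mnmDE !mnmE load_cat. Qed.

Definition edge_pack N m := exists s,
  [/\ size s = N, edges s & forall v, (load D s v <= m v)%N].

Definition frac_pack m := exists s,
  [/\ (0 < size s)%N, edges s & forall v, (load D s v <= size s * m v)%N].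

Lemma supp_ideal_closed (Q : 'X_{1..n} -> Prop) (G : set {mpoly k[n]}) h :
  (forall m m', Q m -> Q (m + m')%MM) ->
  (forall g, G g -> forall m, m \in msupp g -> Q m) ->
  ideal_span G h -> forall m, m \in msupp h -> Q m.
Proof.
move=> Qup GQ; apply: (ideal_span_min (Q := fun h => forall m, m \in msupp h -> Q m)) => //.
- by move=> m; rewrite msupp0.
- by move=> x y xQ yQ m /msuppD_le; rewrite mem_cat => /orP[/xQ|/yQ].
- move=> c x xQ m /msuppM_le/allpairsP[[m1 m2] /= [_ m2x ->]].
  by rewrite addmC; apply: Qup; apply: xQ.
Qed.

Lemma edge_packD N m m' : edge_pack N m -> edge_pack N (m + m')%MM.
Proof.
case=> s [sN sE sv]; exists s; split=> // v; rewrite mnmDE.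
exact: leq_trans (sv v) (leq_addr _ _).
Qed.

Lemma edge_genE i j : 'X_i * 'X_j ^+ w j = 'X_[mload [:: (i, j)]] :> {mpoly k[n]}.
Proof.
rewrite mpolyXn -mpolyXD; congr 'X_[_]; apply/mnmP => v.
rewrite mnmDE mulmnE !mnm1E mnmE /load big_cons big_nil addn0 /=.
by case: (eqVneq j v) => [->|_]; rewrite ?mul1n.
Qed.

Lemma edge_ideal_supp h : I h -> forall m, m \in msupp h -> edge_pack 1 m.
Proof.
apply: supp_ideal_closed; first exact: edge_packD.
move=> _ [i [j [eij ->]]] m; rewrite edge_genE => /mem_msuppXP <-.
by exists [:: (i, j)]; split=> //=; [rewrite eij|move=> v; rewrite mnmE].
Qed.

Lemma edge_ideal_exp_supp N h : ideal_exp I N h ->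
  forall m, m \in msupp h -> edge_pack N m.
Proof.
apply: supp_ideal_closed; first exact: edge_packD.
move=> _ [g [Ig ->]]; elim: N g Ig => [|N IH] g Ig m.
  by rewrite big_ord0 msupp1 inE => /eqP->; exists [::]; split=> // v; rewrite /load big_nil.
rewrite big_ord_recl => /msuppM_le/allpairsP[[m1 m2] /= [m1g m2g ->]].
have [s1 [s1N s1E s1v]] := edge_ideal_supp (Ig _) m1g.
have [s2 [s2N s2E s2v]] := IH _ (fun i => Ig _) _ m2g.
exists (s1 ++ s2); split.
- by rewrite size_cat s1N s2N.
- by rewrite all_cat s1E.
- by move=> v; rewrite load_cat mnmDE leq_add.
Qed.

Lemma edge_ideal_exp_mload s : edges s -> ideal_exp I (size s) 'X_[mload s].
Proof.
elim: s => [|[i j] s IH] /=; first by move=> _; apply: ideal_exp0.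
case/andP=> eij sE; rewrite -cat1s mload_cat mpolyXD -add1n.
apply: ideal_expM (IH sE); apply: ideal_exp1; apply: ideal_span_gen.
by exists i, j; split=> //; rewrite edge_genE.
Qed.

Lemma mpolyX_factor m m' : (forall v, (m v <= m' v)%N) ->
  'X_[m'] = 'X_[m' - m] * 'X_[m] :> {mpoly k[n]}.
Proof.
move=> mm'; rewrite -mpolyXD; congr 'X_[_]; apply/mnmP => v.
by rewrite mnmDE mnmBE subnK.
Qed.

Lemma edge_idealP h : I h <-> forall m, m \in msupp h -> edge_pack 1 m.
Proof.
split; first exact: edge_ideal_supp.
move=> hP; rewrite (mpolyE h) big_seq; apply: ideal_span_sum => m /hP.
case=> s [sz sE sv]; case: s sz sE sv => [|[i j] [|]] //= _ /andP[eij _] sv.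
rewrite -mul_mpolyC; apply: ideal_spanM.
rewrite (@mpolyX_factor (mload [:: (i, j)])) => [|v]; last by rewrite mnmE.
apply: ideal_spanM; apply: ideal_span_gen.
by exists i, j; split=> //; rewrite edge_genE.
Qed.

Lemma frac_pack_integral m : frac_pack m -> integral_closure I 'X_[m].
Proof.
case=> s [s0 sE sv]; apply: (integral_closure_expr s0); rewrite mpolyXn.
rewrite (@mpolyX_factor (mload s)) => [|v]; last by rewrite mulmnE mnmE mulnC.
by apply: ideal_spanM; apply: edge_ideal_exp_mload.
Qed.

(** Each power of the leading monomial, multiplied by a fixed monomial x^c, contains
as many edges as its exponent. Two of these packings are comparable, in the
multiplicities of the edges as well as in the unused exponents, and their
difference no longer involves c. *)
Lemma frac_pack_mlead f : f != 0 -> integral_closure I f -> frac_pack (mlead f).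
Proof.
move=> f0 If.
have [[e0 ee]|noe] := EM (exists e, edge D e.1 e.2); last first.
  have [d [a [d0 aI]]] := If; rewrite big_nat big1 ?addr0.
    by move/eqP; rewrite expf_eq0 (negPf f0) andbF.
  move=> i id; suff -> : a i = 0 by rewrite mul0r.
  apply: msuppnil0; case E : (msupp _) => [//|m r].
  have := edge_ideal_exp_supp (aI i id) (m := m); rewrite E mem_head => /(_ isT).
  case=> s [sz sE _]; case: s sz sE => [|e s] sz; first by move: id; rewrite -sz.
  by case/andP=> ee _; case: noe; exists e.
have [d dP] := integral_closure_powers If.
pose c := mload (nseq d e0).
have Ic : ideal_exp I d 'X_[c].
  rewrite -[d in ideal_exp I d](size_nseq d e0); apply: edge_ideal_exp_mload.
  by rewrite all_nseq ee orbT.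
have packs N : edge_pack N (c + mlead f *+ N)%MM.
  apply: (edge_ideal_exp_supp (dP _ Ic N)).
  have X0 : 'X_[c] != 0 :> {mpoly k[n]} by rewrite -msupp_eq0 msuppX.
  rewrite -{1}(mleadXm k c) -mleadX // -mleadM ?expf_neq0 //.
  by apply: mlead_supp; rewrite mulf_neq0 ?expf_neq0.
have [S SP] := choice packs.
(* multiplicities of the edges, then unused exponents *)
pose F N (t : 'I_n * 'I_n + 'I_n) := match t with
  | inl e => count_mem e (S N)
  | inr v => (c v + mlead f v * N - load D (S N) v)%N end.
have [i [j [ij Fij]]] := dickson F.
have [si Ei vi] := SP i; have [sj Ej vj] := SP j.
have [s' subs' pers'] : exists2 s', subseq s' (S j) & perm_eq (S i) s'.
  by apply/count_subseqP => e; apply: (Fij (inl e)).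
have [s pers] := perm_to_subseq subs'.
have {}pers : perm_eq (S j) (S i ++ s).
  by apply: (perm_trans pers); rewrite perm_cat2r perm_sym.
have sz : size s = (j - i)%N by have := perm_size pers; rewrite size_cat si sj; lia.
exists s; split; first by rewrite sz subn_gt0.
  by have := perm_all (fun e => edge D e.1 e.2) pers; rewrite Ej all_cat => /esym/andP[].
move=> v; have := Fij (inr v); rewrite /F.
have := vi v; have := vj v; rewrite !mnmDE !mulmnE sz (load_perm v pers) load_cat.
by rewrite mulnBl ![(_ * mlead f v)%N]mulnC; have := leq_mul2l (mlead f v) i j; lia.
Qed.

Lemma integral_closureP f :
  integral_closure I f <-> forall m, m \in msupp f -> frac_pack m.
Proof.
split; last first.
  move=> fP; rewrite (mpolyE f) big_seq; elim/big_rec: _ => [|m x /fP fm Ix].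
    exact: integral_closure0.
  apply: integral_closureD Ix; rewrite -mul_mpolyC; apply: integral_closureM.
  exact: frac_pack_integral.
have [N] := ubnP (size (msupp f)); elim: N f => // N IH f szf If m mf.
have f0 : f != 0 by apply: contraTneq mf => ->; rewrite msupp0.
have lf := frac_pack_mlead f0 If.
have [->//|nm] := eqVneq m (mlead f).
have prem := msupp_rem f (mlead f).
apply: (IH (f - f@_(mlead f) *: 'X_[mlead f])).
- rewrite (perm_size prem) size_rem ?mlead_supp //.
  have := mlead_supp f0; case: (msupp f) szf => //= x r; rewrite !ltnS //.
- apply: (integral_closureB If); rewrite -mul_mpolyC; apply: integral_closureM.
  exact: frac_pack_integral.
- by rewrite (perm_mem prem) mem_rem_uniq ?msupp_uniq // inE nm.
Qed.
End MonomialMembership.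

(** * Local cohomology of monomial ideals *)

Section LaurentCoefficients.
Variables (k : fieldType) (n : nat).
Local Notation S := {mpoly k[n]}.
Local Notation vset := {set 'I_n}.
Local Notation degree := {ffun 'I_n -> int}.
Implicit Types (A B : vset) (a : degree) (x y : S^o * nat) (u : S) (t : nat).

(** The coefficient of u at an exponent vector that may be negative, 0 in that case. *)
Definition lcoef u (e : 'I_n -> int) : k :=
  if [forall v, 0 <= e v] then u@_[multinom `|e v|%N | v < n] else 0.

Lemma eq_lcoef u e e' : e =1 e' -> lcoef u e = lcoef u e'.
Proof. by move=> /funext ->. Qed.

Lemma lcoef0 e : lcoef 0 e = 0.
Proof. by rewrite /lcoef mcoeff0 if_same. Qed.

Lemma lcoefD u1 u2 e : lcoef (u1 + u2) e = lcoef u1 e + lcoef u2 e.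
Proof. by rewrite /lcoef; case: ifP; rewrite ?addr0 ?mcoeffD. Qed.

Lemma lcoefN u e : lcoef (- u) e = - lcoef u e.
Proof. by rewrite /lcoef; case: ifP; rewrite ?oppr0 ?mcoeffN. Qed.

Lemma lcoef_nat u (m : 'X_{1..n}) : lcoef u (fun v => (m v)%:Z) = u@_m.
Proof.
rewrite /lcoef ifT; last by apply/forallP.
by congr (u@__); apply/mnmP => v; rewrite mnmE.
Qed.

Lemma lcoef_Xmul (m : 'X_{1..n}) u e :
  lcoef ('X_[m] * u) e = lcoef u (fun v => e v - (m v)%:Z).
Proof.
rewrite /lcoef; case: (boolP [forall v, 0 <= e v - (m v)%:Z]) => [/forallP h|h].
  have e0 v : 0 <= e v by have := h v; lia.
  rewrite ifT; last exact/forallP.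
  rewrite mulrC (_ : [multinom _ | v < n] = (m + [multinom `|e v - (m v)%:Z|%N | v < n])%MM).
    exact: mcoeffMX.
  by apply/mnmP => v; rewrite mnmDE !mnmE; have := h v; lia.
case: ifP => // /forallP e0; apply: memN_msupp_eq0; apply: contra h.
move=> /msuppM_le/allpairsP[[m1 m2] /= [+ _ em]]; rewrite msuppX inE => /eqP em1.
apply/forallP => v; have := congr1 (fun m : 'X_{1..n} => m v) em.
by rewrite mnmE mnmDE em1; have := e0 v; lia.
Qed.

(** The exponents of the numerator in degree a of a fraction over x_A ^ t. *)
Definition lexp A t a : 'I_n -> int := fun v => a v + (t * (v \in A))%N%:Z.

Definition loc_coef A x a : k := lcoef x.1 (lexp A x.2 a).

Lemma xprodE A t : xprod k A ^+ t = 'X_[[multinom (t * (v \in A))%N | v < n]].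
Proof.
rewrite /xprod -(big_morph (fun m => 'X_[m] : S) (@mpolyXD n k) (mpolyX0 n k)) mpolyXn.
congr 'X_[_]; apply/mnmP => v.
rewrite mulmnE mnm_sumE mnmE mulnC; congr (_ * _)%N.
under eq_bigr do rewrite mnm1E.
case: (boolP (v \in A)) => vA; last first.
  by rewrite big1 // => i iA; case: eqVneq => // iv; rewrite -iv iA in vA.
rewrite (bigD1 v) //= eqxx big1 // => i /andP[_]; by case: eqVneq.
Qed.

Lemma loc_coef_shift A u t s a :
  loc_coef A (xprod k A ^+ s * u, (t + s)%N) a = loc_coef A (u, t) a.
Proof.
rewrite /loc_coef xprodE lcoef_Xmul; apply: eq_lcoef => v; rewrite /lexp /= mnmE.
by rewrite mulnDl PoszD addrA addrK.
Qed.

Lemma loc_coef_poly A u t (m : 'X_{1..n}) :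
  u@_m = loc_coef A (u, t) [ffun v => (m v)%:Z - (t * (v \in A))%N%:Z].
Proof.
by rewrite -lcoef_nat; apply: eq_lcoef => v; rewrite /lexp ffunE subrK.
Qed.

(** After reduction to a common denominator, the Laurent coefficients of fractions
are the coefficients of their numerators. *)
Lemma loc_eqP A x y :
  loc_eq A x y <-> forall a, loc_coef A x a = loc_coef A y a.
Proof.
case: x y => [u t] [v s]; rewrite /loc_eq /=; split.
  move=> [r]; rewrite -[_ *: _]/(xprod k A ^+ r * (xprod k A ^+ s * u - xprod k A ^+ t * v)).
  move=> /eqP; rewrite mulf_eq0 expf_eq0 subr_eq0 => /orP[/andP[_]|/eqP e a].
    have := xprodE A 1; rewrite expr1 => ->; by rewrite -msupp_eq0 msuppX.
  by rewrite -(loc_coef_shift A u t s) e addnC loc_coef_shift.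
move=> e; exists 0%N; rewrite expr0 scale1r; apply/eqP; rewrite subr_eq0; apply/eqP.
apply/mpolyP => m; rewrite !(loc_coef_poly A _ (t + s)).
etransitivity; first exact: (loc_coef_shift A u t s).
by rewrite e [(t + s)%N]addnC; symmetry; apply: (loc_coef_shift A v s t).
Qed.

Lemma loc_coef0 A a : loc_coef A (loc_zero S^o) a = 0.
Proof. exact: lcoef0. Qed.

Lemma loc_coefD A x y a :
  loc_coef A (loc_add A x y) a = loc_coef A x a + loc_coef A y a.
Proof.
case: x y => [u t] [v s].
rewrite -(loc_coef_shift A u t s) -(loc_coef_shift A v s t) [(s + t)%N]addnC.
exact: lcoefD.
Qed.

Lemma loc_coef_sign A (d : nat) x a :
  loc_coef A (loc_scale ((-1) ^+ d : S) x) a = (-1) ^+ d * loc_coef A x a.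
Proof.
rewrite /loc_coef /= -[_ *: _]/((-1) ^+ d * (x.1 : S)) -[in LHS]signr_odd -[in RHS]signr_odd.
by case: (odd d); rewrite ?expr0 ?expr1 ?mul1r ?mulN1r ?lcoefN.
Qed.

Lemma loc_coef_map B l x a : l \in B ->
  loc_coef B (loc_map l x) a = loc_coef (B :\ l) x a.
Proof.
move=> lB; rewrite /loc_coef /= -[_ *: _]/('X_l ^+ x.2 * (x.1 : S)) mpolyXn lcoef_Xmul.
apply: eq_lcoef => v; rewrite /lexp mulmnE mnm1E !inE [v == l]eq_sym.
by case: eqVneq => [<-|_] /=; rewrite ?lB; lia.
Qed.

(** In each degree a of Z^n the differential of the complex of localizations is the
coboundary of functions on vertex sets. *)
Lemma loc_coef_diff (c : vset -> S^o * nat) B a :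
  loc_coef B (cech_diff c B) a = coboundary (fun A => loc_coef A (c A) a) B.
Proof.
rewrite /cech_diff (big_morph (fun x => loc_coef B x a) (id1 := 0) (op1 := +%R)); last first.
- exact: loc_coef0.
- by move=> x y; apply: loc_coefD.
by apply: eq_bigr => l lB; rewrite loc_coef_sign loc_coef_map.
Qed.
End LaurentCoefficients.

Section MonomialIdeal.
Variables (k : fieldType) (n : nat).
Local Notation S := {mpoly k[n]}.
Local Notation vset := {set 'I_n}.
Local Notation degree := {ffun 'I_n -> int}.
Implicit Types (A B : vset) (a : degree) (t : nat).

(** U a is the family of the sets A such that x^a lies in the localization at x_A of
the ideal L spanned by the monomials in Mon. *)
Variables (L : set S) (Mon : 'X_{1..n} -> Prop) (U : degree -> pred vset).
Hypothesis LP : forall f, L f <-> forall m, m \in msupp f -> Mon m.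
Hypothesis Mon_up : forall m m', Mon m -> Mon (m + m')%MM.
Hypothesis U_up : forall a A B, A \subset B -> U a A -> U a B.
Hypothesis UP : forall a A, U a A <->
  exists t (m : 'X_{1..n}), (forall v, (m v)%:Z = lexp A t a v) /\ Mon m.

Definition mexp A t a : 'X_{1..n} := [multinom `|lexp A t a v|%N | v < n].

Definition fits A t a := (forall v, 0 <= lexp A t a v) /\ Mon (mexp A t a).

Lemma mexpE A t a v : 0 <= lexp A t a v -> (mexp A t a v)%:Z = lexp A t a v.
Proof. by move=> h; rewrite mnmE gez0_abs. Qed.

Lemma fits_leq A t t' a : (t <= t')%N -> fits A t a -> fits A t' a.
Proof.
move=> /subnKC <- [e0 Me]; have e0' v : 0 <= lexp A (t + (t' - t)) a v.
  by have := e0 v; rewrite /lexp mulnDl PoszD; lia.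
split=> //; have -> : mexp A (t + (t' - t)) a =
    (mexp A t a + [multinom ((t' - t) * (v \in A))%N | v < n])%MM.
  apply/mnmP => v; apply/eqP; rewrite -eqz_nat mexpE // mnmDE PoszD mexpE //.
  by rewrite mnmE /lexp mulnDl PoszD addrA.
exact: Mon_up.
Qed.

Lemma fits_ex A a : U a A -> exists t, fits A t a.
Proof.
case/UP=> t [m [mE Mm]]; exists t; split=> [v|]; first by rewrite -mE.
suff -> : mexp A t a = m by [].
by apply/mnmP => v; rewrite mnmE -mE.
Qed.

Lemma fits_U A t a : fits A t a -> U a A.
Proof. by case=> e0 Me; apply/UP; exists t, (mexp A t a); split=> // v; apply: mexpE. Qed.

(** A common denominator exponent, as finitely many degrees are involved. *)
Lemma fits_uniform (r : seq degree) :
  exists t, forall a A, a \in r -> U a A -> fits A t a.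
Proof.
suff [t tP] : exists t, forall p, p \in [seq (a, A) | a <- r, A <- enum {: vset}] ->
    U p.1 p.2 -> fits p.2 t p.1.
  exists t => a A ar; apply: (tP (a, A)); apply/allpairsP; exists (a, A).
  by rewrite ar mem_enum.
elim: [seq _ | _ <- _, _ <- _] => [|p l [t tP]]; first by exists 0%N.
have [Up|nUp] := boolP (U p.1 p.2); last first.
  exists t => q; rewrite inE => /orP[/eqP->|/tP//].
  by rewrite (negPf nUp).
have [s sP] := fits_ex Up; exists (maxn s t) => q; rewrite inE => /orP[/eqP-> _|ql Uq].
  by apply: fits_leq sP; apply: leq_maxl.
by apply: fits_leq (tP q ql Uq); apply: leq_maxr.
Qed.

Definition monom A t a (c : k) : S := c *: 'X_[mexp A t a].

Lemma lcoef_monom A t a a' c : (c != 0 -> fits A t a) ->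
  lcoef (monom A t a c) (lexp A t a') = if a == a' then c else 0.
Proof.
have [-> _|c0 /(_ isT)[e0 _]] := eqVneq c 0.
  by rewrite /monom scale0r lcoef0 if_same.
rewrite /lcoef mcoeffZ mcoeffX; have [<-|na] := eqVneq a a'.
  rewrite ifT; last exact/forallP.
  by rewrite (_ : mexp A t a == _) ?mulr1 //; apply/eqP/mnmP => v; rewrite !mnmE.
case: ifP => // /forallP e0'; case: eqP => [em|_]; last by rewrite mulr0.
case/eqP: na; apply/ffunP => v; have := congr1 (fun m : 'X_{1..n} => (m v)%:Z) em.
by rewrite mexpE // mnmE gez0_abs ?e0' // => /addIr.
Qed.

Lemma mdeg_mexp A t a : (forall v, 0 <= lexp A t a v) ->
  (mdeg (mexp A t a))%:Z = \sum_v a v + (t * #|A|)%N%:Z.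
Proof.
move=> e0; rewrite mdegE (big_morph Posz PoszD (erefl : Posz 0 = 0%R)).
under eq_bigr do rewrite mexpE //; rewrite big_split /=; congr (_ + _).
rewrite -(big_morph Posz PoszD (erefl : Posz 0 = 0%R)) -big_distrr /=.
rewrite -sum1_card [in RHS]big_mkcond /=; congr (Posz (_ * _)).
Qed.

Lemma component_sum A t (j : int) (r : seq degree) (g : degree -> k) :
  (forall a, a \in r -> g a != 0 -> fits A t a) ->
  (forall a, a \in r -> \sum_v a v = j) ->
  loc_degree (ideal_component L) A j (\sum_(a <- r) monom A t a (g a) : S^o, t).
Proof.
move=> gfit rj; rewrite /loc_degree /=.
set u : S := \sum_(a <- r) _.
have usupp m : m \in msupp u -> exists2 a, a \in r & g a != 0 /\ m = mexp A t a.
  move=> /msupp_sum_le; rewrite filter_predT.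
  case/flatten_mapP=> a ar; rewrite /monom; have [->|ga] := eqVneq (g a) 0.
    by rewrite scale0r msupp0.
  by rewrite msuppMCX // inE => /eqP->; exists a.
have udeg m : m \in msupp u -> (mdeg m)%:Z = j + (t * #|A|)%N%:Z.
  move=> /usupp[a ar [ga ->]]; have [e0 _] := gfit a ar ga.
  by rewrite mdeg_mexp // rj.
split.
  by apply/LP => m /usupp[a ar [ga ->]]; have [] := gfit a ar ga.
case E : (msupp u) => [|m l]; first by left; apply: msuppnil0.
right; exists (mdeg m); first by rewrite udeg // E mem_head.
apply/dhomogP => m' m'u; apply/eqP; rewrite -eqz_nat !udeg //.
by rewrite E mem_head.
Qed.

Lemma component_coef A x (j : int) a : loc_degree (ideal_component L) A j x ->
  loc_coef A x a != 0 -> U a A /\ \sum_v a v = j.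
Proof.
case: x => u t; rewrite /loc_degree /= => -[/LP Lu udeg].
rewrite /loc_coef /lcoef /=; case: ifP => [/forallP e0|]; last by rewrite eqxx.
rewrite -[X in u@_X]/(mexp A t a) -mcoeff_msupp => mu.
split; first by apply: (@fits_U A t); split=> //; apply: Lu.
case: udeg mu => [->|[d dE /dhomogP ud] mu]; first by rewrite msupp0.
have := mdeg_mexp e0; rewrite (ud _ mu) -dE => /eqP; rewrite eq_sym.
by move=> /eqP/addIr.
Qed.

(** A cocycle in one degree a is turned into fractions with monomial numerators.
Conversely a cocycle of fractions has nonzero coefficients in finitely many
degrees a; primitives in these degrees are put over a common denominator and
added. *)
Theorem local_cohomology_monomial (i : nat) (j : int) :
  local_cohomology_neq0 (ideal_component L) i j <->
  exists a, \sum_v a v = j /\ ~ acyclic k i (U a).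
Proof.
split; last first.
  move=> [a [aj na]] sub; apply: na => f sf cf.
  have [t tP] := fits_uniform [:: a].
  pose c A : S^o * nat := (\sum_(a' <- [:: a]) monom A t a' (f A) : S, t).
  have ffit A : f A != 0 -> fits A t a.
    move=> fA; apply: tP; rewrite ?mem_head //.
    by apply: contra_neqT fA => /sf.
  have cE A a' : loc_coef A (c A) a' = if a == a' then f A else 0.
    by rewrite /loc_coef /c /= big_seq1 lcoef_monom //; apply: ffit.
  have [|b bdeg bE] := sub c.
    split.
      move=> A _; apply: component_sum => a'; rewrite inE => /eqP-> //.
      exact: ffit.
    move=> B cB; apply/loc_eqP => a'; rewrite loc_coef_diff loc_coef0.
    have [<-|na] := eqVneq a a'; last first.
      by rewrite /coboundary big1 // => l _; rewrite cE (negPf na) mulr0.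
    rewrite (eq_coboundary (g := f)) => [|l _]; last by rewrite cE eqxx.
    have [UB|nUB] := boolP (U a B); first exact: cf.
    apply: big1 => l _; rewrite sf ?mulr0 //; apply: contra nUB; apply: U_up.
    exact: subD1set.
  exists (restrict_to (U a) (fun A => loc_coef A (b A) a)); first exact: restrict_supported.
  move=> A UA cA; have /loc_eqP/(_ a) := bE A cA.
  rewrite cE eqxx loc_coef_diff => ->; apply: eq_coboundary => l lA.
  rewrite /restrict_to; case: ifPn => // nU; apply/eqP; apply: contraNT nU => nz.
  have cAl : #|A :\ l| = i.-1 by rewrite -cA (cardsD1 l A) lA.
  by have [] := component_coef (bdeg _ cAl) nz.
move=> neq; apply: contrapT => no; apply: neq => c [cdeg ccyc].
have ac a : \sum_v a v = j -> acyclic k i (U a).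
  by move=> aj; apply: contrapT => na; apply: no; exists a.
pose gam a A := if #|A| == i then loc_coef A (c A) a else 0.
have gamU a A : gam a A != 0 -> U a A /\ \sum_v a v = j.
  rewrite /gam; case: (#|A| =P i) => [cA|]; last by rewrite eqxx.
  exact: component_coef (cdeg A cA).
have gamE a A : #|A| = i -> gam a A = loc_coef A (c A) a.
  by rewrite /gam => /eqP->.
have primitives a : exists g : vset -> k, \sum_v a v = j ->
    supported (U a) g /\ forall A, #|A| = i -> gam a A = coboundary g A.
  have [aj|naj] := EM (\sum_v a v = j); last by exists (fun=> 0).
  have [||g sg gE] := ac a aj (gam a).
  - by move=> A nU; apply/eqP; apply: contraNT nU => /gamU[].
  - move=> B UB cB; have /loc_eqP/(_ a) := ccyc B cB.
    rewrite loc_coef_diff loc_coef0 => e; rewrite -[RHS]e; apply: eq_coboundary => l lB.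
    by rewrite gamE //; move: cB; rewrite (cardsD1 l) lB => -[].
  exists g => _; split=> // A cA; have [UA|nUA] := boolP (U a A); first exact: gE.
  have -> : gam a A = 0 by apply/eqP; apply: contraNT nUA => /gamU[].
  symmetry; apply: big1 => l _; rewrite sg ?mulr0 //; apply: contra nUA; apply: U_up.
  exact: subD1set.
have [G GP] := choice primitives.
pose dg A (m : 'X_{1..n}) : degree :=
  [ffun v => (m v)%:Z - ((c A).2 * (v \in A))%N%:Z].
(* the degrees that occur in the fractions c A *)
pose cands : seq degree :=
  flatten [seq map (dg A) (msupp ((c A).1 : S)) | A <- enum {: vset}].
pose r : seq degree := [seq a : degree <- undup cands | \sum_v a v == j].
have rj a : a \in r -> \sum_v a v = j by rewrite mem_filter => /andP[/eqP].
have gam_r a A : gam a A != 0 -> a \in r.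
  move=> nz; have [_ aj] := gamU a A nz; rewrite mem_filter aj eqxx mem_undup /=.
  apply/flatten_mapP; exists A; first by rewrite mem_enum.
  move: nz; rewrite /gam; case: (#|A| =P i) => [_|]; last by rewrite eqxx.
  rewrite /loc_coef /lcoef; case: ifP => [/forallP e0|]; last by rewrite eqxx.
  rewrite -mcoeff_msupp => mu; apply/mapP; eexists; first exact: mu.
  by apply/ffunP => v; rewrite ffunE mnmE gez0_abs // /lexp addrK.
have [t tP] := fits_uniform r.
have Gfit a A : a \in r -> G a A != 0 -> fits A t a.
  move=> ar nz; apply: tP => //; apply: contraNT nz => nU.
  by have [sg _] := GP a (rj a ar); rewrite sg.
pose b A : S^o * nat := (\sum_(a <- r) monom A t a (G a A) : S, t).
have bE A a : loc_coef A (b A) a = if a \in r then G a A else 0.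
  rewrite /loc_coef /b /= (big_morph (fun u => lcoef u (lexp A t a)) (id1 := 0) (op1 := +%R)).
  - have -> : \sum_(a' <- r) lcoef (monom A t a' (G a' A)) (lexp A t a) =
        \sum_(a' <- r) (if a' == a then G a' A else 0).
      by apply: eq_big_seq => a' a'r; rewrite lcoef_monom //; apply: Gfit.
    rewrite -big_mkcond /= -big_filter; case: ifPn => ar.
      by rewrite filter_pred1_uniq ?big_seq1 // filter_uniq ?undup_uniq.
    by rewrite big_filter big_seq_cond big1 // => a' /andP[a'r /eqP e]; rewrite -e a'r in ar.
  - by move=> u u'; apply: lcoefD.
  - exact: lcoef0.
exists b => [A cA|A cA].
  by apply: component_sum => // a ar; apply: Gfit.
apply/loc_eqP => a; rewrite loc_coef_diff -gamE //.
have [ar|nar] := boolP (a \in r).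
  have [_ ->//] := GP a (rj a ar); apply: eq_coboundary => l _.
  by rewrite bE ar.
have -> : gam a A = 0 by apply/eqP; apply: contraNT nar => /gam_r.
by symmetry; apply: big1 => l _; rewrite bE (negPf nar) mulr0.
Qed.
End MonomialIdeal.

(** * Regularity *)

(** The supremum is the maximum in the bounded case, and +oo otherwise. *)
Lemma int_supremum_exists (E : set int) d0 : E d0 ->
  exists y : \bar int, supremums [set d%:E | d in E]%classic y.
Proof.
move=> Ed0; have [[r rE]|nb] := EM (exists r, forall d, E d -> d <= r).
  (* the maximum is r - m for the least m such that r - m is in E *)
  pose Q (m : nat) := `[< E (r - m%:Z) >].
  have exQ : exists m, Q m.
    exists `|r - d0|%N; apply/asboolP; rewrite gez0_abs ?subr_ge0 ?rE //.
    by rewrite opprB addrC subrK.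
  case: (ex_minnP exQ) => m /asboolP Em mmin; exists (r - m%:Z)%:E; split.
    move=> _ [d Ed <-]; rewrite lee_fin.
    have := mmin `|r - d|%N; have rd := rE d Ed.
    have -> : Q `|r - d|%N.
      by apply/asboolP; rewrite gez0_abs ?subr_ge0 // opprB addrC subrK.
    by move=> /(_ isT); lia.
  by move=> y; apply; exists (r - m%:Z).
exists +oo%E; split=> [_ [d Ed <-]|[r| |] yub]; rewrite ?leey //.
  case: nb; exists r => d Ed; rewrite -lee_fin; apply: yub; by exists d.
by have := yub _ (ex_intro2 _ _ d0 Ed0 erefl).
Qed.

Lemma int_supremumP (E : set int) d0 : E d0 ->
  supremums [set d%:E | d in E]%classic (supremum -oo%E [set d%:E | d in E]%classic).
Proof.
move=> Ed0; rewrite /supremum ifF; last first.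
  by apply/negbTE/set0P; exists d0%:E; exists d0.
by apply: xgetPex; apply: int_supremum_exists Ed0.
Qed.

Lemma reg_le (k : fieldType) (n : nat) (M M' : lmodType {mpoly k[n]})
    (L : int -> set M) (L' : int -> set M') :
  (forall i j, local_cohomology_neq0 L i j ->
     exists i' j', local_cohomology_neq0 L' i' j' /\ i%:Z + j <= i'%:Z + j') ->
  (reg L <= reg L')%E.
Proof.
move=> LL'; rewrite /reg; set E := [set d | _]%classic; set E' := [set d | _]%classic.
have EE' d : E d -> exists2 d', E' d' & d <= d'.
  by move=> [i [j [/LL'[i' [j' [Lij' le]]] ->]]]; exists (i'%:Z + j') => //; exists i', j'.
have [[d0 Ed0]|E0] := EM (exists d, E d); last first.
  suff -> : [set d%:E | d in E]%classic = classical_sets.set0 by rewrite supremum0 leNye.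
  by apply/seteqP; split=> // x [d Ed _]; case: E0; exists d.
have [d0' Ed0' _] := EE' d0 Ed0.
have [_] := int_supremumP Ed0; apply=> _ [d /EE'[d' Ed' dd'] <-].
have [ub _] := int_supremumP Ed0'.
by apply: le_trans (ub d'%:E _); [rewrite lee_fin|exists d'].
Qed.

Section Localization.
Variables (n : nat) (D : weighted_oriented_graph n).

(** Clearing the denominator: a large power of x_A makes room for s on A. *)
Lemma pack_localE (s : seq ('I_n * 'I_n)) (a : {ffun 'I_n -> int}) (A : {set 'I_n}) :
  (0 < size s)%N ->
  (forall v, v \notin A -> ((load D s v)%:Z <= (size s)%:Z * a v)) <->
  exists t (m : 'X_{1..n}), (forall v, (m v)%:Z = lexp A t a v) /\
    forall v, (load D s v <= size s * m v)%N.
Proof.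
move=> s0; split=> [h|[t [m [mE sm]]] v vA]; last first.
  by have := mE v; rewrite /lexp (negPf vA) muln0 addr0 => <-; rewrite -PoszM lez_nat.
pose t := (\sum_v (`|a v| + load D s v))%N.
have tv v : (`|a v| + load D s v <= t)%N by rewrite /t (bigD1 v) //= leq_addr.
have e0 v : 0 <= lexp A t a v.
  rewrite /lexp; have := tv v; case: (boolP (v \in A)) => vA; first lia.
  move=> _; rewrite muln0 addr0 -(pmulr_rge0 _ (_ : 0 < (size s)%:Z)) ?ltz_nat //.
  by apply: le_trans (h v vA).
exists t, [multinom `|lexp A t a v|%N | v < n]; split=> [v|v].
  by rewrite mnmE gez0_abs.
rewrite -lez_nat PoszM mnmE gez0_abs // /lexp; case: (boolP (v \in A)) => vA; last first.
  by rewrite muln0 addr0; apply: h.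
apply: (@le_trans _ _ (a v + (t * true)%N%:Z)); first by have := tv v; lia.
by rewrite ler_peMl ?(e0 v) //; have := e0 v; rewrite /lexp vA.
Qed.

Lemma in_closure_atP a A : in_closure_at D a A <->
  exists t (m : 'X_{1..n}), (forall v, (m v)%:Z = lexp A t a v) /\ frac_pack D m.
Proof.
split=> [/asboolP[s [s0 sE /(pack_localE _ _ s0)[t [m [mE sm]]]]]|].
  by exists t, m; split=> //; exists s.
case=> t [m [mE [s [s0 sE sm]]]]; apply/asboolP; exists s; split=> //.
by apply/(pack_localE _ _ s0); exists t, m.
Qed.

Lemma in_ideal_at_packP a A : in_ideal_at D a A <->
  exists t (m : 'X_{1..n}), (forall v, (m v)%:Z = lexp A t a v) /\ edge_pack D 1 m.
Proof.
split=> [/in_ideal_atP[i [j [eij h]]]|[t [m [mE [s [sz sE sm]]]]]].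
  have [|t [m [mE sm]]] := (pack_localE (s := [:: (i, j)]) a A isT).1.
    by move=> v /h; rewrite mul1r.
  exists t, m; split=> //; exists [:: (i, j)]; split=> //=; first by rewrite eij.
  by move=> v; have := sm v; rewrite mul1n.
case: s sz sE sm => [|[i j] [|]] //= _ /andP[eij _] sm.
apply/in_ideal_atP; exists i, j; split=> //.
have h : exists t (m : 'X_{1..n}), (forall v, (m v)%:Z = lexp A t a v) /\
    forall v, (load D [:: (i, j)] v <= size [:: (i, j)] * m v)%N.
  by exists t, m; split=> // v; rewrite mul1n.
by move=> v /((pack_localE a A (isT : 0 < size [:: (i, j)])%N).2 h); rewrite mul1r.
Qed.

Lemma frac_packD (m m' : 'X_{1..n}) : frac_pack D m -> frac_pack D (m + m')%MM.
Proof.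
case=> s [s0 sE sm]; exists s; split=> // v; apply: leq_trans (sm v) _.
by rewrite mnmDE leq_mul2l leq_addr orbT.
Qed.

End Localization.

Theorem theorem1p2 (k : fieldType) (n : nat) (D : weighted_oriented_graph n) :
  (reg_ideal (integral_closure (edge_ideal k D))
     <= reg_ideal (edge_ideal k D))%E.
Proof.
apply: reg_le => i j.
have closureP := local_cohomology_monomial (@integral_closureP k n D)
  (@frac_packD n D) (@in_closure_atS n D) (@in_closure_atP n D).
move=> /closureP[a [<- /in_ideal_at_dominates[b [i' [nb le_ab]]]]].
exists i', (\sum_v b v); split=> //.
apply/(local_cohomology_monomial (@edge_idealP k n D) (@edge_packD n D 1)
  (@in_ideal_atS n D) (@in_ideal_at_packP n D)).
by exists b.
Qed.
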